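(* Let $K$ be a field, let $R$ be a finite-dimensional $K$-algebra, let $M$ be a finite-dimensional $R$-bimodule, let $n\geq 2$ be an integer, and let $\varphi:M^{\otimes_R n}\to R$ be an associative morphism of $R$-bimodules. Let $A(R,M,\varphi)$ be the associated $\mathbb{Z}_n$-graded algebra. The following assertions hold. (i) If $M$ is an invertible $R$-bimodule, then $A(R,M,\varphi)$ is $\widehat{n-1}$-faithful. If moreover $M^{\otimes_R (n-1)}\simeq R^*$ as left $R$-modules, then $A(R,M,\varphi)$ is $\widehat{n-1}$-graded Frobenius, in particular it is Frobenius. (ii) If $M$ is an invertible $R$-bimodule, then $A(R,M,\varphi)$ is quasi-Frobenius if and only if $R$ is quasi-Frobenius. (iii) If $\varphi$ is an isomorphism, then the $\mathbb{Z}_n$-graded algebra $A(R,M,\varphi)$ is strongly graded. (iv) If $\varphi$ is an isomorphism and there exists $0\leq i\leq n-1$ such that $M^{\otimes_R i}\simeq R^*$ as left $R$-modules, then $A(R,M,\varphi)$ is $\hat{i}$-graded Frobenius, in particular it is Frobenius.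
   Context: All algebras, vector spaces and linear duals are over the field $K$; $R^*=\mathrm{Hom}_K(R,K)$ is an $R$-bimodule via $(r\rightharpoonup r^* )(s)=r^*(sr)$ and $(r^*\leftharpoonup r)(s)=r^*(rs)$. Convention: $M^{\otimes_R 0}=R$, $M^{\otimes_R 1}=M$, and $M^{\otimes_R i}$ is the $i$-fold tensor product over $R$. A bimodule morphism $\varphi:M^{\otimes_R n}\to R$ is associative if $\varphi(m_1\otimes_R\cdots\otimes_R m_n)m_{n+1}=m_1\varphi(m_2\otimes_R\cdots\otimes_R m_{n+1})$ for all $m_1,\ldots,m_{n+1}\in M$. Let $T_R(M)=\bigoplus_{i\geq 0}M^{\otimes_R i}$ be the tensor algebra. $A(R,M,\varphi)$ is the factor algebra of $T_R(M)$ by the two-sided ideal generated by all elements $m_1\otimes_R\cdots\otimes_R m_n-\varphi(m_1\otimes_R\cdots\otimes_R m_n)$. It is identified with $R\oplus M\oplus\cdots\oplus M^{\otimes_R(n-1)}$, where the multiplication is tensor concatenation if the total length is less than $n$, and otherwise concatenation followed by applying $\varphi$ to $n$ successive tensor positions (the choice is irrelevant by associativity); elements of $R$ act via the bimodule structure. It is $\mathbb{Z}_n$-graded, with homogeneous component of degree $\hat{i}$ equal to $M^{\otimes_R i}$ for $0\leq i\leq n-1$, where $\hat{i}$ is the class of $i$ modulo $n$. A bimodule $M$ is invertible if there is an $R$-bimodule $N$ with $M\otimes_R N\simeq N\otimes_R M\simeq R$ as $R$-bimodules. A finite-dimensional algebra $B$ is quasi-Frobenius if $B$ is an injective left $B$-module,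 and Frobenius if $B^*\simeq B$ as left $B$-modules. Let $A$ be an algebra graded by a group $G$ and $\sigma\in G$. $A$ is $\sigma$-faithful if for any $g\in G$ and $a_g\in A_g$ with $A_{\sigma g^{-1}}a_g=0$ one has $a_g=0$. $A$ is strongly graded if $A_gA_h=A_{gh}$ for all $g,h\in G$. If $A$ is finite-dimensional, $A^*$ is graded by $(A^* )_g=\{a^*\in A^* : a^*(A_h)=0\text{ for all }h\neq g^{-1}\}$, $A(\sigma)$ is the left $A$-module $A$ with grading $A(\sigma)_g=A_{g\sigma}$, and $A$ is $\sigma$-graded Frobenius if $A^*\simeq A(\sigma)$ as graded left $A$-modules. Here $G=\mathbb{Z}_n$ (additive). *)

(* Defs.v *)
From HB Require Import structures.
From mathcomp Require Import all_boot all_algebra falgebra.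
From mathcomp Require Import boolp.

Set Implicit Arguments.
Unset Strict Implicit.
Unset Printing Implicit Defensive.

Import GRing.Theory VectorInternalTheory.

Local Open Scope ring_scope.
Local Open Scope quotient_scope.

Definition finite_dimensional (K : fieldType) (V : lmodType K) : Prop :=
  exists (I : finType) (b : I -> V),
    forall v, exists c : I -> K, v = \sum_i c i *: b i.

(* Bimodules over a K-algebra are K-central: both actions are K-bilinear. The *)
(* underlying space is not assumed to be finite-dimensional.                  *)
Record bimodule (K : fieldType) (R : falgType K) := Bimodule {
  bimodule_sort :> lmodType K;
  lact : R -> bimodule_sort -> bimodule_sort;
  ract : bimodule_sort -> R -> bimodule_sort;
  lact_linear : forall r, linear (lact r);
  lact_linearl : forall m, linear (lact^~ m);
  ract_linear : forall m, linear (ract m);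
  ract_linearl : forall r, linear (ract^~ r);
  lact1 : forall m, lact 1 m = m;
  lactA : forall r s m, lact (r * s) m = lact r (lact s m);
  ract1 : forall m, ract m 1 = m;
  ractA : forall m r s, ract m (r * s) = ract (ract m r) s;
  lract : forall r m s, lact r (ract m s) = ract (lact r m) s
}.

Section BimoduleTheory.
Variables (K : fieldType) (R : falgType K) (M : bimodule R).
Implicit Types (m : M) (r s : R).

Definition lact_fun r : M -> M := lact r.
Definition ract_fun r : M -> M := fun m => ract m r.
Definition lact_val m : R -> M := fun r => lact r m.
Definition ract_val m : R -> M := ract m.

HB.instance Definition _ r :=
  GRing.isLinear.Build K M M *:%R (lact_fun r) (lact_linear r).
HB.instance Definition _ r :=
  GRing.isLinear.Build K M M *:%R (ract_fun r) (ract_linearl r).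
HB.instance Definition _ m :=
  GRing.isLinear.Build K R M *:%R (lact_val m) (lact_linearl m).
HB.instance Definition _ m :=
  GRing.isLinear.Build K R M *:%R (ract_val m) (ract_linear m).

Lemma lactD r m1 m2 : lact r (m1 + m2) = lact r m1 + lact r m2.
Proof. exact: (linearD (lact_fun r)). Qed.
Lemma lactDl r s m : lact (r + s) m = lact r m + lact s m.
Proof. exact: (linearD (lact_val m)). Qed.
Lemma ractD m r s : ract m (r + s) = ract m r + ract m s.
Proof. exact: (linearD (ract_val m)). Qed.
Lemma ractDl m1 m2 r : ract (m1 + m2) r = ract m1 r + ract m2 r.
Proof. exact: (linearD (ract_fun r)). Qed.
Lemma lact0 r : lact r (0 : M) = 0.
Proof. exact: (linear0 (lact_fun r)). Qed.
Lemma lact0l m : lact 0 m = 0.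
Proof. exact: (linear0 (lact_val m)). Qed.
Lemma ract0 m : ract m 0 = 0.
Proof. exact: (linear0 (ract_val m)). Qed.
Lemma ract0l r : ract (0 : M) r = 0.
Proof. exact: (linear0 (ract_fun r)). Qed.
Lemma lactZ k r m : lact r (k *: m) = k *: lact r m.
Proof. exact: (linearZ_LR (lact_fun r)). Qed.
Lemma lactZl k r m : lact (k *: r) m = k *: lact r m.
Proof. exact: (linearZ_LR (lact_val m)). Qed.
Lemma ractZ k m r : ract m (k *: r) = k *: ract m r.
Proof. exact: (linearZ_LR (ract_val m)). Qed.
Lemma ractZl k m r : ract (k *: m) r = k *: ract m r.
Proof. exact: (linearZ_LR (ract_fun r)). Qed.

End BimoduleTheory.

Section BimoduleMorphisms.
Variables (K : fieldType) (R : falgType K).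
Implicit Types M N : bimodule R.

Definition lmodule_hom M N (f : M -> N) : Prop :=
  linear f /\ forall r m, f (lact r m) = lact r (f m).

Definition bimodule_hom M N (f : M -> N) : Prop :=
  lmodule_hom f /\ forall m r, f (ract m r) = ract (f m) r.

Definition lmodule_iso M N : Prop :=
  exists2 f : M -> N, lmodule_hom f & bijective f.

Definition bimodule_iso M N : Prop :=
  exists2 f : M -> N, bimodule_hom f & bijective f.

End BimoduleMorphisms.

Local Obligation Tactic := idtac.

Section RegularDual.
Variables (K : fieldType) (R : falgType K).

Program Definition regular_bimodule : bimodule R :=
  @Bimodule K R R (fun r m => r * m) (fun m r => m * r) _ _ _ _ _ _ _ _ _.
Next Obligation. by move=> r k m1 m2; rewrite /= mulrDr scalerAr. Qed.
Next Obligation. by move=> m k r s; rewrite /= mulrDl scalerAl. Qed.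
Next Obligation. by move=> m k r s; rewrite /= mulrDr scalerAr. Qed.
Next Obligation. by move=> r k m1 m2; rewrite /= mulrDl scalerAl. Qed.
Next Obligation. exact: mul1r. Qed.
Next Obligation. by move=> r s m; rewrite /= mulrA. Qed.
Next Obligation. exact: mulr1. Qed.
Next Obligation. by move=> m r s; rewrite /= mulrA. Qed.
Next Obligation. by move=> r m s; rewrite /= mulrA. Qed.

(* (r f)(s) = f (s r) and (f r)(s) = f (r s).                                 *)
Definition dual_lact (r : R) (f : 'Hom(R, K^o)) := (f \o amulr r)%VF.
Definition dual_ract (f : 'Hom(R, K^o)) (r : R) := (f \o amull r)%VF.

Lemma dual_lactE r f s : dual_lact r f s = f (s * r).
Proof. by rewrite comp_lfunE lfunE. Qed.

Lemma dual_ractE f r s : dual_ract f r s = f (r * s).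
Proof. by rewrite comp_lfunE lfunE. Qed.

Let dE := (dual_lactE, dual_ractE, add_lfunE, scale_lfunE).

Program Definition dual_bimodule : bimodule R :=
  @Bimodule K R 'Hom(R, K^o) dual_lact dual_ract _ _ _ _ _ _ _ _ _.
Next Obligation. by move=> r k f g; apply/lfunP=> s; rewrite !dE. Qed.
Next Obligation.
by move=> f k r s; apply/lfunP=> t; rewrite !dE mulrDr -scalerAr linearP.
Qed.
Next Obligation.
by move=> f k r s; apply/lfunP=> t; rewrite !dE mulrDl -scalerAl linearP.
Qed.
Next Obligation. by move=> r k f g; apply/lfunP=> s; rewrite !dE. Qed.
Next Obligation. by move=> f; apply/lfunP=> s; rewrite !dE mulr1. Qed.
Next Obligation. by move=> r s f; apply/lfunP=> t; rewrite !dE ?mulrA. Qed.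
Next Obligation. by move=> f; apply/lfunP=> s; rewrite !dE mul1r. Qed.
Next Obligation. by move=> f r s; apply/lfunP=> t; rewrite !dE ?mulrA. Qed.
Next Obligation. by move=> r f s; apply/lfunP=> t; rewrite !dE ?mulrA. Qed.

End RegularDual.

Section TensorProduct.
Variables (K : fieldType) (R : falgType K) (X Y : bimodule R).

(* A list [:: (x1, y1); ..; (xk, yk)] stands for the formal sum of the        *)
(* x_i (x) y_i; tensor_rel is the congruence defining X (x)_R Y. Homogeneity  *)
(* over K comes from the balancing rule, both actions being K-central.        *)
Inductive tensor_rel : seq (X * Y) -> seq (X * Y) -> Prop :=
| tensor_refl s : tensor_rel s s
| tensor_sym s t : tensor_rel s t -> tensor_rel t s
| tensor_trans s t u : tensor_rel s t -> tensor_rel t u -> tensor_rel s u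
| tensor_cat s1 t1 s2 t2 :
    tensor_rel s1 t1 -> tensor_rel s2 t2 -> tensor_rel (s1 ++ s2) (t1 ++ t2)
| tensor_catC s t : tensor_rel (s ++ t) (t ++ s)
| tensor_zero y : tensor_rel [:: (0, y)] [::]
| tensor_addl x1 x2 y : tensor_rel [:: (x1 + x2, y)] [:: (x1, y); (x2, y)]
| tensor_addr x y1 y2 : tensor_rel [:: (x, y1 + y2)] [:: (x, y1); (x, y2)]
| tensor_bal x r y : tensor_rel [:: (ract x r, y)] [:: (x, lact r y)].

Definition tensor_relb (s t : seq (X * Y)) : bool := `[< tensor_rel s t >].

Lemma tensor_relb_refl : reflexive tensor_relb.
Proof. by move=> s; apply/asboolP; exact: tensor_refl. Qed.
Lemma tensor_relb_sym : symmetric tensor_relb.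
Proof.
by move=> s t; apply/asboolP/asboolP=> h; exact: tensor_sym.
Qed.
Lemma tensor_relb_trans : transitive tensor_relb.
Proof.
move=> s t u /asboolP h1 /asboolP h2; apply/asboolP; exact: tensor_trans h1 h2.
Qed.

Canonical tensor_equiv :=
  EquivRel tensor_relb tensor_relb_refl tensor_relb_sym tensor_relb_trans.

Definition tensor_type := {eq_quot tensor_equiv}.
HB.instance Definition _ := Choice.on tensor_type.
HB.instance Definition _ := EqQuotient.on tensor_type.

Local Notation T := tensor_type.
Implicit Types (u v w : T) (s t : seq (X * Y)).

Definition tclass s : T := \pi s.

Lemma tclassP s t : tensor_rel s t <-> tclass s = tclass t.
Proof.
by split=> [h|/eqquotP /asboolP //]; apply/eqquotP/asboolP.
Qed.

Lemma treprK u : tclass (repr u) = u. Proof. exact: reprK. Qed.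

Lemma trepr_class s : tensor_rel (repr (tclass s)) s.
Proof. by apply/tclassP; rewrite treprK. Qed.

Definition tmap_seq (g : X -> X) (h : Y -> Y) s :=
  [seq (g xy.1, h xy.2) | xy <- s].

Lemma tmap_seq_rel (g : X -> X) (h : Y -> Y) :
  (forall x1 x2, g (x1 + x2) = g x1 + g x2) ->
  (forall y1 y2, h (y1 + y2) = h y1 + h y2) ->
  (forall x r, g (ract x r) = ract (g x) r) ->
  (forall r y, h (lact r y) = lact r (h y)) ->
  forall s t, tensor_rel s t -> tensor_rel (tmap_seq g h s) (tmap_seq g h t).
Proof.
move=> gD hD gR hR s t; elim=> {s t}.
- by move=> s; exact: tensor_refl.
- by move=> s t _; exact: tensor_sym.
- by move=> s t u _ h1 _; exact: tensor_trans.
- by move=> s1 t1 s2 t2 _ h1 _ h2; rewrite /tmap_seq !map_cat; exact: tensor_cat.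
- by move=> s t; rewrite /tmap_seq !map_cat; exact: tensor_catC.
- move=> y; have g0 : g 0 = 0.
    by apply: (addrI (g 0)); rewrite -gD !addr0.
  by rewrite /= g0; exact: tensor_zero.
- by move=> x1 x2 y; rewrite /= gD; exact: tensor_addl.
- by move=> x y1 y2; rewrite /= hD; exact: tensor_addr.
- by move=> x r y; rewrite /= gR hR; exact: tensor_bal.
Qed.

Definition tadd u v := tclass (repr u ++ repr v).
Definition tzero := tclass [::].
Definition topp u := tclass (tmap_seq -%R id (repr u)).
Definition tscale (k : K) u := tclass (tmap_seq ( *:%R k) id (repr u)).
Definition tlact (r : R) u := tclass (tmap_seq (lact r) id (repr u)).
Definition tract u (r : R) := tclass (tmap_seq id (fun y => ract y r) (repr u)).

Lemma tadd_class s t : tadd (tclass s) (tclass t) = tclass (s ++ t).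
Proof. by apply/tclassP; apply: tensor_cat; exact: trepr_class. Qed.

Lemma ractNl x r : ract (- x : X) r = - ract x r.
Proof. exact: (linearN (ract_fun r)). Qed.

Lemma topp_class s : topp (tclass s) = tclass (tmap_seq -%R id s).
Proof.
apply/tclassP; apply: tmap_seq_rel; last exact: trepr_class; try by [].
- by move=> x1 x2; rewrite opprD.
- by move=> x r; rewrite ractNl.
Qed.

Lemma tscale_class k s : tscale k (tclass s) = tclass (tmap_seq ( *:%R k) id s).
Proof.
apply/tclassP; apply: tmap_seq_rel; last exact: trepr_class; try by [].
- by move=> x1 x2; rewrite scalerDr.
- by move=> x r; rewrite ractZl.
Qed.

Lemma tlact_class r s : tlact r (tclass s) = tclass (tmap_seq (lact r) id s).
Proof.
apply/tclassP; apply: tmap_seq_rel; last exact: trepr_class; try by [].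
- by move=> x1 x2; rewrite lactD.
- by move=> x r'; rewrite lract.
Qed.

Lemma tract_class r s : tract (tclass s) r = tclass (tmap_seq id (fun y => ract y r) s).
Proof.
apply/tclassP; apply: tmap_seq_rel; last exact: trepr_class; try by [].
- by move=> y1 y2; rewrite ractDl.
- by move=> r' y; rewrite lract.
Qed.

Lemma tclass_ind (P : T -> Prop) : (forall s, P (tclass s)) -> forall u, P u.
Proof. by move=> h u; rewrite -(treprK u). Qed.

Lemma taddA : associative tadd.
Proof.
elim/tclass_ind=> s; elim/tclass_ind=> t; elim/tclass_ind=> u.
by rewrite !tadd_class catA.
Qed.
Lemma taddC : commutative tadd.
Proof.
elim/tclass_ind=> s; elim/tclass_ind=> t.
by rewrite !tadd_class; apply/tclassP; exact: tensor_catC.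
Qed.
Lemma tadd0 : left_id tzero tadd.
Proof. by elim/tclass_ind=> s; rewrite tadd_class. Qed.
Lemma taddN : left_inverse tzero topp tadd.
Proof.
have tclass_cons xy t : tclass (xy :: t) = tadd (tclass [:: xy]) (tclass t).
  by rewrite tadd_class.
elim/tclass_ind=> s; rewrite topp_class; elim: s => [|[x y] s IHs].
  by rewrite tadd_class.
rewrite -[tmap_seq _ _ _]/((- x, y) :: tmap_seq -%R id s).
rewrite (tclass_cons _ (tmap_seq _ _ s)) (tclass_cons _ s).
rewrite -taddA [X in tadd _ X]taddA [X in tadd _ (tadd X _)]taddC.
rewrite -[X in tadd _ X]taddA IHs [tadd _ tzero]taddC tadd0 tadd_class.
apply/tclassP; apply: tensor_trans (tensor_zero y).
by apply: tensor_sym; rewrite -(addNr x); exact: tensor_addl.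
Qed.

HB.instance Definition _ := GRing.isZmodule.Build T taddA taddC tadd0 taddN.

Lemma tclass_cat s t : tclass (s ++ t) = tclass s + tclass t.
Proof. by rewrite -tadd_class. Qed.

Definition tpure x y : T := tclass [:: (x, y)].

Lemma tclassE s : tclass s = \sum_(xy <- s) tpure xy.1 xy.2.
Proof.
elim: s => [|[x y] s IHs]; first by rewrite big_nil.
by rewrite big_cons -IHs -cat1s tclass_cat.
Qed.

Lemma tpureDl x1 x2 y : tpure (x1 + x2) y = tpure x1 y + tpure x2 y.
Proof. by rewrite -tclass_cat; apply/tclassP; exact: tensor_addl. Qed.
Lemma tpureDr x y1 y2 : tpure x (y1 + y2) = tpure x y1 + tpure x y2.
Proof. by rewrite -tclass_cat; apply/tclassP; exact: tensor_addr. Qed.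
Lemma tpure_bal x r y : tpure (ract x r) y = tpure x (lact r y).
Proof. by apply/tclassP; exact: tensor_bal. Qed.

Lemma tensor_ind (P : T -> Prop) :
  P 0 -> (forall u v, P u -> P v -> P (u + v)) ->
  (forall x y, P (tpure x y)) -> forall u, P u.
Proof.
move=> P0 PD Pp; elim/tclass_ind=> s; rewrite tclassE.
by elim/big_ind: _.
Qed.

Lemma tmapD (f : seq (X * Y) -> seq (X * Y)) (F : T -> T) :
  (forall s t, f (s ++ t) = f s ++ f t) ->
  (forall s, F (tclass s) = tclass (f s)) -> {morph F : u v / u + v}.
Proof.
move=> fcat FE; elim/tclass_ind=> s; elim/tclass_ind=> t.
by rewrite -tclass_cat !FE fcat tclass_cat.
Qed.

Lemma tscaleD k : {morph tscale k : u v / u + v}.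
Proof.
by apply: tmapD (tscale_class k) => s t; rewrite /tmap_seq map_cat.
Qed.
Lemma tlactD r : {morph tlact r : u v / u + v}.
Proof.
by apply: tmapD (tlact_class r) => s t; rewrite /tmap_seq map_cat.
Qed.
Lemma tractD r : {morph tract^~ r : u v / u + v}.
Proof.
by apply: tmapD (tract_class r) => s t; rewrite /tmap_seq map_cat.
Qed.

Lemma tscale_pure k x y : tscale k (tpure x y) = tpure (k *: x) y.
Proof. exact: tscale_class. Qed.
Lemma tlact_pure r x y : tlact r (tpure x y) = tpure (lact r x) y.
Proof. exact: tlact_class. Qed.
Lemma tract_pure r x y : tract (tpure x y) r = tpure x (ract y r).
Proof. exact: tract_class. Qed.

Lemma tadditive_ext (F G : T -> T) :
  {morph F : u v / u + v} -> {morph G : u v / u + v} ->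
  (forall x y, F (tpure x y) = G (tpure x y)) -> F =1 G.
Proof.
move=> FD GD FG u.
have F0 : F 0 = 0 by apply: (addrI (F 0)); rewrite -FD !addr0.
have G0 : G 0 = 0 by apply: (addrI (G 0)); rewrite -GD !addr0.
elim/tensor_ind: u => [|u v hu hv|x y]; first by rewrite F0 G0.
  by rewrite FD GD hu hv.
exact: FG.
Qed.

Lemma tscaleA a b u : tscale a (tscale b u) = tscale (a * b) u.
Proof.
apply: (tadditive_ext (F := fun u => tscale a (tscale b u))).
- by move=> v w; rewrite !tscaleD.
- exact: tscaleD.
- by move=> x y; rewrite !tscale_pure scalerA.
Qed.
Lemma tscale1 : left_id 1 tscale.
Proof.
move=> u; apply: (tadditive_ext (G := id)) => //; first exact: tscaleD.
by move=> x y; rewrite tscale_pure scale1r.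
Qed.
Lemma tscaleDr : right_distributive tscale +%R.
Proof. by move=> k u v; exact: tscaleD. Qed.
Lemma tscaleDl u : {morph tscale^~ u : a b / a + b}.
Proof.
move=> a b.
apply: (tadditive_ext (G := fun u => tscale a u + tscale b u)).
- exact: tscaleD.
- by move=> v w; rewrite !tscaleD addrACA.
- by move=> x y; rewrite !tscale_pure scalerDl tpureDl.
Qed.

HB.instance Definition _ :=
  GRing.Zmodule_isLmodule.Build K T tscaleA tscale1 tscaleDr tscaleDl.

Lemma tpureZl k x y : tpure (k *: x) y = k *: tpure x y.
Proof. by rewrite -tscale_pure. Qed.
Lemma tpureZr k x y : tpure x (k *: y) = k *: tpure x y.
Proof.
by rewrite -tpureZl -[y in LHS]lact1 -lactZl -tpure_bal ractZ ract1.
Qed.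

Lemma tpure0l y : tpure 0 y = 0.
Proof. by rewrite -(scale0r (0 : X)) tpureZl scale0r. Qed.
Lemma tpure0r x : tpure x 0 = 0.
Proof. by rewrite -(scale0r (0 : Y)) tpureZr scale0r. Qed.

Lemma tpure_suml (I : finType) (F : I -> X) y :
  tpure (\sum_i F i) y = \sum_i tpure (F i) y.
Proof.
elim/big_rec2: _ => [|i _ u _ <-]; [exact: tpure0l | exact: tpureDl].
Qed.
Lemma tpure_sumr (I : finType) x (F : I -> Y) :
  tpure x (\sum_i F i) = \sum_i tpure x (F i).
Proof.
elim/big_rec2: _ => [|i _ u _ <-]; [exact: tpure0r | exact: tpureDr].
Qed.

Lemma tlinear (F : T -> T) :
  {morph F : u v / u + v} ->
  (forall k x y, F (tpure (k *: x) y) = k *: F (tpure x y)) -> linear F.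
Proof.
move=> FD FZ k u v; rewrite FD; congr (_ + _).
apply: (tadditive_ext (F := fun u => F (k *: u)) (G := fun u => k *: F u)).
- by move=> u1 u2; rewrite scalerDr FD.
- by move=> u1 u2; rewrite FD scalerDr.
- by move=> x y; rewrite -tpureZl FZ.
Qed.

Lemma tlinearl (F : R -> T -> T) :
  (forall r, {morph F r : u v / u + v}) ->
  (forall (k : K) (r s : R) x y,
     F (k *: r + s) (tpure x y) = k *: F r (tpure x y) + F s (tpure x y)) ->
  forall u, linear (F^~ u).
Proof.
move=> FD FP u k r s.
apply: (tadditive_ext (G := fun u => k *: F r u + F s u)).
- exact: FD.
- by move=> v w; rewrite !FD scalerDr addrACA.
- by move=> x y; exact: FP.
Qed.

Program Definition tensor : bimodule R :=
  @Bimodule K R T tlact tract _ _ _ _ _ _ _ _ _.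
Next Obligation.
move=> r; apply: (tlinear (F := tlact r) (tlactD r)) => k x y.
by rewrite !tlact_pure lactZ tpureZl.
Qed.
Next Obligation.
move=> u; apply: (tlinearl (F := tlact) tlactD) => k r s x y.
by rewrite !tlact_pure lactDl lactZl tpureDl tpureZl.
Qed.
Next Obligation.
move=> u; apply: (tlinearl (F := fun r u => tract u r) tractD) => k r s x y.
by rewrite !tract_pure ractD ractZ tpureDr tpureZr.
Qed.
Next Obligation.
move=> r; apply: (tlinear (F := tract^~ r) (tractD r)) => k x y.
by rewrite !tract_pure tpureZl.
Qed.
Next Obligation.
apply: (tadditive_ext (G := id)) => //; first exact: tlactD.
by move=> x y; rewrite tlact_pure lact1.
Qed.
Next Obligation.
move=> r s; apply: (tadditive_ext (G := fun u => tlact r (tlact s u))).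
- exact: tlactD.
- by move=> u v; rewrite !tlactD.
- by move=> x y; rewrite !tlact_pure lactA.
Qed.
Next Obligation.
apply: (tadditive_ext (F := tract^~ 1) (G := id)) => //; first exact: tractD.
by move=> x y; rewrite tract_pure ract1.
Qed.
Next Obligation.
move=> u r s; move: u; apply: (tadditive_ext (F := tract^~ (r * s))
                      (G := fun u => tract (tract u r) s)).
- exact: tractD.
- by move=> u v; rewrite !tractD.
- by move=> x y; rewrite !tract_pure ractA.
Qed.
Next Obligation.
move=> r u s; move: u; apply: (tadditive_ext (F := fun u => tlact r (tract u s))
                      (G := fun u => tract (tlact r u) s)).
- by move=> u v; rewrite tractD tlactD.
- by move=> u v; rewrite tlactD tractD.
- by move=> x y; rewrite !(tlact_pure, tract_pure).
Qed.

Definition pure (x : X) (y : Y) : tensor := tpure x y.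

Section Lift.
Variables (V : zmodType) (f : X -> Y -> V).

Definition balanced : Prop :=
  [/\ forall x1 x2 y, f (x1 + x2) y = f x1 y + f x2 y,
      forall x y1 y2, f x (y1 + y2) = f x y1 + f x y2
    & forall x r y, f (ract x r) y = f x (lact r y)].

Definition tensor_lift (u : tensor) : V := \sum_(xy <- repr u) f xy.1 xy.2.

Hypothesis fbal : balanced.

Lemma tensor_lift_class s :
  tensor_lift (tclass s) = \sum_(xy <- s) f xy.1 xy.2.
Proof.
have [fDl fDr fR] := fbal.
have: tensor_rel (repr (tclass s)) s by exact: trepr_class.
rewrite /tensor_lift; move: (repr _) => t; elim=> {s t} //.
- by move=> s t u _ -> _ ->.
- by move=> s1 t1 s2 t2 _ h1 _ h2; rewrite !big_cat /= h1 h2.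
- by move=> s t; rewrite !big_cat /= addrC.
- move=> y; rewrite big_cons big_nil addr0 /=.
  by apply: (addrI (f 0 y)); rewrite -fDl !addr0.
- by move=> x1 x2 y; rewrite !big_cons !big_nil !addr0 fDl.
- by move=> x y1 y2; rewrite !big_cons !big_nil !addr0 fDr.
- by move=> x r y; rewrite !big_cons !big_nil !addr0 fR.
Qed.

Lemma tensor_lift_pure x y : tensor_lift (pure x y) = f x y.
Proof. by rewrite tensor_lift_class big_seq1. Qed.

Lemma tensor_liftD : {morph tensor_lift : u v / u + v}.
Proof.
elim/tclass_ind=> s; elim/tclass_ind=> t.
by rewrite -tclass_cat !tensor_lift_class big_cat.
Qed.

End Lift.
End TensorProduct.

Section TensorPower.
Variables (K : fieldType) (R : falgType K) (M : bimodule R).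

Fixpoint tpow (n : nat) : bimodule R :=
  match n with
  | 0 => regular_bimodule R
  | k.+1 => if k is _.+1 then tensor M (tpow k) else M
  end.

(* m (x) x, up to the identification M (x)_R R = M when k = 0.                *)
Definition tcons k : M -> tpow k -> tpow k.+1 :=
  match k return M -> tpow k -> tpow k.+1 with
  | 0 => fun m r => ract m r
  | _.+1 => fun m x => pure m x
  end.

(* ptensor n m = m_1 (x) .. (x) m_n, where m_(i+1) is written m i.            *)
Fixpoint ptensor n (m : nat -> M) : tpow n :=
  match n return tpow n with
  | 0 => 1 : R
  | k.+1 => tcons (m 0) (ptensor k (fun i => m i.+1))
  end.

Definition tpow_lift (V : zmodType) k : (M -> tpow k -> V) -> tpow k.+1 -> V :=
  match k return (M -> tpow k -> V) -> tpow k.+1 -> V with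
  | 0 => fun f m => f m (1 : R)
  | _.+1 => fun f u => tensor_lift f u
  end.

Lemma tcons_bal k : balanced (@tcons k).
Proof.
case: k => [|k]; split.
- by move=> m1 m2 r; exact: ractDl.
- by move=> m r s; exact: ractD.
- by move=> m r s; exact: (esym (ractA m r s)).
- by move=> m1 m2 x; exact: tpureDl.
- by move=> m x1 x2; exact: tpureDr.
- by move=> m r x; exact: tpure_bal.
Qed.

Lemma tconsDl k m1 m2 (x : tpow k) : tcons (m1 + m2) x = tcons m1 x + tcons m2 x.
Proof. by case: (tcons_bal k). Qed.
Lemma tconsDr k m (x1 x2 : tpow k) : tcons m (x1 + x2) = tcons m x1 + tcons m x2.
Proof. by case: (tcons_bal k). Qed.
Lemma tcons_lr k m r (x : tpow k) : tcons (ract m r) x = tcons m (lact r x).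
Proof. by case: (tcons_bal k). Qed.

Lemma tconsZl k a m (x : tpow k) : tcons (a *: m) x = a *: tcons m x.
Proof. by case: k x => [|k] x; [exact: ractZl | exact: tpureZl]. Qed.

Lemma tconsZr k a m (x : tpow k) : tcons m (a *: x) = a *: tcons m x.
Proof. by case: k x => [|k] x; [exact: ractZ | exact: tpureZr]. Qed.

Lemma tcons0r k m : tcons m (0 : tpow k) = 0.
Proof. by rewrite -(scale0r (0 : tpow k)) tconsZr scale0r. Qed.

Lemma lact_tcons k r m (x : tpow k) : lact r (tcons m x) = tcons (lact r m) x.
Proof. by case: k x => [|k] x; [exact: lract | exact: tlact_pure]. Qed.

Lemma ract_tcons k m (x : tpow k) r : ract (tcons m x) r = tcons m (ract x r).
Proof.
by case: k x => [|k] x; [exact: (esym (ractA m x r)) | exact: tract_pure].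
Qed.

Lemma tpow_lift_cons (V : zmodType) k (f : M -> tpow k -> V) m x :
  balanced f -> tpow_lift f (tcons m x) = f m x.
Proof.
case: k f x => [|k] f x fbal; last exact: tensor_lift_pure.
case: (fbal) => _ _ fR; rewrite /= fR; congr (f m _); exact: mulr1.
Qed.

Lemma tpow_liftD (V : zmodType) k (f : M -> tpow k -> V) :
  balanced f -> {morph tpow_lift f : u v / u + v}.
Proof.
case: k f => [|k] f fbal; last exact: tensor_liftD.
by case: fbal => fD _ _ u v; exact: fD.
Qed.

Lemma tpow_ind k (P : tpow k.+1 -> Prop) :
  P 0 -> (forall u v, P u -> P v -> P (u + v)) ->
  (forall m x, P (tcons m x)) -> forall u, P u.
Proof.
case: k P => [|k] P P0 PD Pc u; last exact: tensor_ind.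
by have := Pc u (1 : R); rewrite /= ract1.
Qed.

Lemma ptensor_ind k (P : tpow k.+1 -> Prop) :
  P 0 -> (forall u v, P u -> P v -> P (u + v)) ->
  (forall m, P (ptensor k.+1 m)) -> forall u, P u.
Proof.
elim: k P => [|k IHk] P P0 PD Pm u.
  by have := Pm (fun=> u); rewrite /= ract1.
elim/tpow_ind: u => // m; apply: IHk.
- by rewrite tcons0r.
- by move=> u v; rewrite tconsDr; exact: PD.
- by move=> w; exact: (Pm (fun i => if i is j.+1 then w j else m)).
Qed.

Lemma eq_ptensor k (v w : nat -> M) :
  (forall i, (i < k)%N -> v i = w i) -> ptensor k v = ptensor k w.
Proof.
elim: k v w => [//|k IHk] v w vw /=.
by rewrite vw // (IHk _ (fun i => w i.+1)) // => i ik; exact: vw.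
Qed.

(* phi (m_1 (x) .. (x) m_n) m_(n+1) = m_1 phi (m_2 (x) .. (x) m_(n+1)).       *)
Definition tassociative n (phi : tpow n -> R) : Prop :=
  forall m : nat -> M,
    lact (phi (ptensor n m)) (m n) =
    ract (m 0) (phi (ptensor n (fun i => m i.+1))).

Record assoc_morphism n := AssocMorphism {
  assoc_morphism_fun :> tpow n -> regular_bimodule R;
  assoc_morphism_hom : bimodule_hom assoc_morphism_fun;
  assoc_morphism_assoc : tassociative assoc_morphism_fun
}.

End TensorPower.

Arguments tcons : simpl never.
Arguments tpow_lift : simpl never.

Section FiniteDimension.
Variable K : fieldType.

Lemma finite_dimensional_vect (V : vectType K) : finite_dimensional V.
Proof.
exists 'I_(\dim {:V}), (fun i : 'I_(\dim {:V}) => (vbasis {:V})`_i) => v.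
exists (fun i => coord (vbasis {:V}) i v).
by apply: coord_vbasis; exact: memvf.
Qed.

Lemma finite_dimensional_axiom (V : lmodType K) :
  finite_dimensional V ->
  exists n, exists2 f : V -> 'rV[K]_n, linear f & bijective f.
Proof.
move=> [I [b bV]]; pose W := {ffun I -> K^o} : vectType K.
pose f (c : W) : V := \sum_i c i *: b i.
have fD c d : f (c + d) = f c + f d.
  by rewrite -big_split; apply: eq_bigr => i _; rewrite ffunE scalerDl.
have fZ a c : f (a *: c) = a *: f c.
  by rewrite scaler_sumr; apply: eq_bigr => i _; rewrite ffunE scalerA.
have f0 : f 0 = 0 by rewrite -(scale0r (0 : W)) fZ scale0r.
have fB c d : f (c - d) = f c - f d by rewrite fD -[- d]scaleN1r fZ scaleN1r.
pose P d := `[< exists2 U : {vspace W},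
                  \dim U = d & forall c, c \in U -> f c = 0 >].
have P0 : exists d, P d.
  exists 0%N; apply/asboolP; exists 0%VS; first exact: dimv0.
  by move=> c; rewrite memv0 => /eqP ->.
have Pmax d : P d -> (d <= \dim {:W})%N.
  by move=> /asboolP[U <- _]; rewrite dimvS ?subvf.
case: (ex_maxnP P0 Pmax) => d /asboolP[U dU U0] Ud {P0 Pmax}.
have kerU c : f c = 0 -> c \in U.
  move=> fc; suff /eqP -> : U == (U + <[c]>)%VS.
    by apply: (subvP (addvSr U <[c]>)); exact: memv_line.
  rewrite eqEdim addvSl dU; apply: Ud; apply/asboolP.
  exists (U + <[c]>)%VS => // _ /memv_addP[u uU [_ /vlineP[a ->] ->]].
  by rewrite fD fZ fc scaler0 addr0 U0.
pose g (w : subvs_of (U^C)%VS) : V := f (vsval w).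
have gI : injective g.
  move=> w1 w2 gw; apply: val_inj; apply/eqP; rewrite -subr_eq0.
  rewrite -memv0 -(capv_compl U) memv_cap; apply/andP; split.
    by apply: kerU; rewrite fB -/(g w1) -/(g w2) gw subrr.
  by rewrite rpredB ?subvsP.
have gS v : exists w, g w = v.
  have [c vE] := bV v; pose c' : W := [ffun i => c i].
  have fc' : f c' = v.
    by rewrite vE; apply: eq_bigr => i _; rewrite ffunE.
  have : c' \in (U + U^C)%VS by rewrite addv_complf memvf.
  case/memv_addP=> u uU [w wC c'E].
  by exists (Subvs wC); rewrite /g -fc' c'E fD (U0 u) ?add0r.
pose h v := sval (cid (gS v)).
have gh v : g (h v) = v by exact: (svalP (cid (gS v))).
have hg : cancel g h by move=> w; apply: gI; rewrite gh.
exists (dim (subvs_of (U^C)%VS)), (fun v => v2r (h v)).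
  move=> a u v; rewrite -linearP; congr v2r; apply: gI.
  by rewrite gh /g linearP /= fD fZ -/(g (h u)) -/(g (h v)) !gh.
exists (fun r => g (r2v r)) => [v|r]; first by rewrite v2rK gh.
by rewrite hg r2vK.
Qed.

Definition finite_dimensional_dim V (fdV : finite_dimensional V) : nat :=
  sval (cid (@finite_dimensional_axiom V fdV)).

Definition finite_dimensional_iso V (fdV : finite_dimensional V) :
  Vector.axiom (finite_dimensional_dim fdV) V :=
  let h := cid2 (svalP (cid (@finite_dimensional_axiom V fdV))) in
  exist2 _ _ (s2val h) (s2valP h) (s2valP' h).

Lemma finite_dimensional_tensor (R : falgType K) (X Y : bimodule R) :
  finite_dimensional X -> finite_dimensional Y ->
  finite_dimensional (tensor X Y).
Proof.
move=> [I [b bX]] [J [d dY]].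
exists (I * J)%type, (fun ij => pure (b ij.1) (d ij.2)) => u.
elim/tensor_ind: u => [|u v [c ->] [e ->]|x y].
- by exists (fun=> 0); rewrite big1 // => i _; rewrite scale0r.
- exists (fun i => c i + e i); rewrite -big_split.
  by apply: eq_bigr => i _; rewrite scalerDl.
have [c ->] := bX x; have [e ->] := dY y.
exists (fun ij => c ij.1 * e ij.2).
rewrite /pure tpure_suml; under eq_bigr => i _ do rewrite tpure_sumr.
rewrite pair_big /=; apply: eq_bigr => -[i j] _ /=.
by rewrite tpureZl tpureZr scalerA.
Qed.

Lemma finite_dimensional_tpow (R : falgType K) (M : bimodule R) k :
  finite_dimensional M -> finite_dimensional (tpow M k).
Proof.
move=> fdM; elim: k => [|[|k] IHk //]; first exact: finite_dimensional_vect.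
exact: finite_dimensional_tensor.
Qed.

End FiniteDimension.

Section FactorAlgebra.
Variables (K : fieldType) (R : falgType K) (M : bimodule R) (p : nat).
Variables (fdM : finite_dimensional M) (phi : assoc_morphism M p.+2).

(* A(R, M, phi) with n = p.+2, as R (+) M (+) .. (+) M^(x)(n - 1). The unused *)
(* arguments are what the algebra structure below depends on.                 *)
Definition factor_alg of finite_dimensional M & assoc_morphism M p.+2 : Type :=
  forall i : 'Z_p.+2, tpow M i.

Local Notation A := (factor_alg fdM phi).
Implicit Types (a b c : A) (m : M) (r : R).

HB.instance Definition _ := Choice.on A.

Lemma factor_ext a b : (forall i, a i = b i) -> a = b.
Proof. exact: functional_extensionality_dep. Qed.

Definition factor_zero : A := fun i => 0.
Definition factor_opp a : A := fun i => - a i.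
Definition factor_add a b : A := fun i => a i + b i.
Definition factor_scale (k : K) a : A := fun i => k *: a i.

Lemma factor_addA : associative factor_add.
Proof. by move=> a b c; apply: factor_ext => i; exact: addrA. Qed.
Lemma factor_addC : commutative factor_add.
Proof. by move=> a b; apply: factor_ext => i; exact: addrC. Qed.
Lemma factor_add0 : left_id factor_zero factor_add.
Proof. by move=> a; apply: factor_ext => i; exact: add0r. Qed.
Lemma factor_addN : left_inverse factor_zero factor_opp factor_add.
Proof. by move=> a; apply: factor_ext => i; exact: addNr. Qed.

HB.instance Definition _ :=
  GRing.isZmodule.Build A factor_addA factor_addC factor_add0 factor_addN.

Lemma factor_scaleA k1 k2 a :
  factor_scale k1 (factor_scale k2 a) = factor_scale (k1 * k2) a.
Proof. by apply: factor_ext => i; exact: scalerA. Qed.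
Lemma factor_scale1 : left_id 1 factor_scale.
Proof. by move=> a; apply: factor_ext => i; exact: scale1r. Qed.
Lemma factor_scaleDr : right_distributive factor_scale +%R.
Proof. by move=> k a b; apply: factor_ext => i; exact: scalerDr. Qed.
Lemma factor_scaleDl a : {morph factor_scale^~ a : k1 k2 / k1 + k2}.
Proof. by move=> k1 k2; apply: factor_ext => i; exact: scalerDl. Qed.

HB.instance Definition _ := GRing.Zmodule_isLmodule.Build K A
  factor_scaleA factor_scale1 factor_scaleDr factor_scaleDl.

Lemma factor0E i : (0 : A) i = 0. Proof. by []. Qed.
Lemma factorDE a b i : (a + b) i = a i + b i. Proof. by []. Qed.
Lemma factorZE k a i : (k *: a) i = k *: a i. Proof. by []. Qed.
Lemma factor_sumE (I : finType) (F : I -> A) i :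
  (\sum_j F j) i = \sum_j F j i.
Proof. by elim/big_rec2: _ => // j _ a _ <-. Qed.

(* The element x of M^(x)k, placed in degree k (zero if n <= k).              *)
Definition tinj k (x : tpow M k) : A :=
  fun i => if @eqP nat k i is ReflectT ki then ecast j (tpow M j) ki x else 0.

Lemma tinj_val (i : 'Z_p.+2) (x : tpow M i) : tinj x i = x.
Proof. by rewrite /tinj; case: eqP => // e; rewrite eq_axiomK. Qed.

Lemma tinj_neq k (x : tpow M k) (i : 'Z_p.+2) : k != i -> tinj x i = 0.
Proof. by rewrite /tinj; case: eqP. Qed.

Lemma tinjD k (x y : tpow M k) : tinj (x + y) = tinj x + tinj y.
Proof.
apply: factor_ext => i; rewrite factorDE /tinj.
by case: eqP => [e|_]; [case: _ / e | rewrite addr0].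
Qed.

Lemma tinjZ k (s : K) (x : tpow M k) : tinj (s *: x) = s *: tinj x.
Proof.
apply: factor_ext => i; rewrite factorZE /tinj.
by case: eqP => [e|_]; [case: _ / e | rewrite scaler0].
Qed.

Lemma tinj0 k : tinj (0 : tpow M k) = 0.
Proof. by rewrite -(scale0r (0 : tpow M k)) tinjZ scale0r. Qed.

Lemma factor_decomp a : a = \sum_i tinj (a i).
Proof.
apply: factor_ext => i; rewrite factor_sumE (bigD1 i) //= tinj_val big1 ?addr0 //.
by move=> j ji; rewrite tinj_neq.
Qed.

(* Left multiplication by m in M: m is concatenated on the left, and phi is   *)
(* applied to the component that thereby reaches length n.                    *)
Definition mcons m a : A := fun i =>
  match i return tpow M i with
  | Ordinal k lt_k =>
    match k return (k < p.+2)%N -> tpow M k with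
    | 0 => fun _ => phi (tcons m (a ord_max))
    | j.+1 => fun lt_j => tcons m (a (Ordinal (ltnW lt_j)))
    end lt_k
  end.

Definition factor_act r a : A := fun i => lact r (a i).

(* Left multiplication by an element of M^(x)k: that by m_1 (x) .. (x) m_k is *)
(* the composite of those by m_1, .., m_k.                                    *)
Fixpoint tmul k : tpow M k -> A -> A :=
  match k return tpow M k -> A -> A with
  | 0 => fun r a => factor_act r a
  | j.+1 => fun x a => tpow_lift (fun m y => mcons m (tmul y a)) x
  end.

Definition factor_mul a b : A := \sum_i tmul (a i) b.
Definition factor_one : A := @tinj 0 (1 : R).

Let phiD : {morph phi : u v / u + v}.
Proof.
by case: (assoc_morphism_hom phi) => -[L _] _ u v; rewrite -[u]scale1r L !scale1r.
Qed.
Let phi0 : phi 0 = 0.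
Proof. by apply: (addrI (phi 0)); rewrite -phiD !addr0. Qed.
Let phiZ k u : phi (k *: u) = k *: phi u.
Proof.
by case: (assoc_morphism_hom phi) => -[L _] _; rewrite -[k *: u]addr0 L phi0 addr0.
Qed.
Let phi_lact r u : phi (lact r u) = r * phi u.
Proof. by case: (assoc_morphism_hom phi) => -[_ ->]. Qed.
Let phi_ract u r : phi (ract u r) = phi u * r.
Proof. by case: (assoc_morphism_hom phi) => _ ->. Qed.

Lemma mconsDl a : {morph mcons^~ a : m1 m2 / m1 + m2}.
Proof.
move=> m1 m2; apply: factor_ext => -[[|j] lt_j]; rewrite factorDE /=.
  by rewrite tconsDl phiD.
by rewrite tconsDl.
Qed.

Lemma mconsDr m : {morph mcons m : a b / a + b}.
Proof.
move=> a b; apply: factor_ext => -[[|j] lt_j]; rewrite factorDE /=.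
  by rewrite factorDE tconsDr phiD.
by rewrite factorDE tconsDr.
Qed.

Lemma mconsZr k m a : mcons m (k *: a) = k *: mcons m a.
Proof.
apply: factor_ext => -[[|j] lt_j]; rewrite factorZE /=.
  by rewrite factorZE tconsZr phiZ.
by rewrite factorZE tconsZr.
Qed.

Lemma mcons_ract m r a : mcons (ract m r) a = mcons m (factor_act r a).
Proof. by apply: factor_ext => -[[|j] lt_j] /=; rewrite tcons_lr. Qed.

Lemma mcons_lact r m a : mcons (lact r m) a = factor_act r (mcons m a).
Proof.
apply: factor_ext => -[[|j] lt_j]; rewrite /factor_act /=.
  by rewrite -lact_tcons phi_lact.
by rewrite -lact_tcons.
Qed.

Lemma factor_actDr r : {morph factor_act r : a b / a + b}.
Proof. by move=> a b; apply: factor_ext => i; exact: lactD. Qed.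
Lemma factor_actDl a : {morph factor_act^~ a : r s / r + s}.
Proof. by move=> r s; apply: factor_ext => i; exact: lactDl. Qed.
Lemma factor_actM r s a : factor_act (r * s) a = factor_act r (factor_act s a).
Proof. by apply: factor_ext => i; exact: lactA. Qed.
Lemma factor_act1 a : factor_act 1 a = a.
Proof. by apply: factor_ext => i; exact: lact1. Qed.

Lemma tmul_props j :
  [/\ forall a, {morph (fun x : tpow M j => tmul x a) : x y / x + y},
      forall (x : tpow M j), {morph tmul x : a b / a + b},
      forall r (x : tpow M j) a, tmul (lact r x) a = factor_act r (tmul x a),
      forall r (x : tpow M j) a, tmul (ract x r) a = tmul x (factor_act r a)
    & forall k (x : tpow M j) a, tmul x (k *: a) = k *: tmul x a].
Proof.
elim: j => [|j [IHl IHr IHlr IHrr IHZ]].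
  split=> /=.
  - exact: factor_actDl.
  - exact: factor_actDr.
  - by move=> r x a; rewrite -factor_actM.
  - by move=> r x a; rewrite -factor_actM.
  - by move=> k x a; apply: factor_ext => i; exact: lactZ.
have bal a : balanced (fun m (y : tpow M j) => mcons m (tmul y a)).
  split=> [m1 m2 y|m y1 y2|m r y]; first exact: mconsDl.
    by rewrite IHl mconsDr.
  by rewrite mcons_ract IHlr.
have D a : {morph (fun x : tpow M j.+1 => tmul x a) : x y / x + y}.
  exact: tpow_liftD.
have E m (y : tpow M j) a : tmul (tcons m y) a = mcons m (tmul y a).
  exact: (tpow_lift_cons _ _ (bal a)).
have Z a : tmul (0 : tpow M j.+1) a = 0.
  by apply: (addrI (tmul (0 : tpow M j.+1) a)); rewrite -D !addr0.
split=> //.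
- move=> x a b; elim/tpow_ind: x => [|x y hx hy|m x]; first by rewrite !Z addr0.
    by rewrite !D hx hy addrACA.
  by rewrite !E IHr mconsDr.
- move=> r x a; elim/tpow_ind: x => [|x y hx hy|m x].
  + by rewrite lact0 Z; apply: factor_ext => i; rewrite /factor_act lact0.
  + by rewrite lactD !D hx hy factor_actDr.
  + by rewrite lact_tcons !E mcons_lact.
- move=> r x a; elim/tpow_ind: x => [|x y hx hy|m x].
  + by rewrite ract0l !Z.
  + by rewrite ractDl !D hx hy.
  + by rewrite ract_tcons !E IHrr.
- move=> k x a; elim/tpow_ind: x => [|x y hx hy|m x].
  + by rewrite !Z scaler0.
  + by rewrite !D hx hy scalerDr.
  + by rewrite !E IHZ mconsZr.
Qed.

Lemma tmulDl j (x y : tpow M j) a : tmul (x + y) a = tmul x a + tmul y a.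
Proof. by have [->] := tmul_props j. Qed.
Lemma tmulDr j (x : tpow M j) a b : tmul x (a + b) = tmul x a + tmul x b.
Proof. by have [_ ->] := tmul_props j. Qed.
Lemma tmul_lact j r (x : tpow M j) a :
  tmul (lact r x) a = factor_act r (tmul x a).
Proof. by have [_ _ ->] := tmul_props j. Qed.
Lemma tmul_ract j r (x : tpow M j) a :
  tmul (ract x r) a = tmul x (factor_act r a).
Proof. by have [_ _ _ ->] := tmul_props j. Qed.
Lemma tmulZr j k (x : tpow M j) a : tmul x (k *: a) = k *: tmul x a.
Proof. by have [_ _ _ _ ->] := tmul_props j. Qed.

Lemma tmul_tcons j m (x : tpow M j) a : tmul (tcons m x) a = mcons m (tmul x a).
Proof.
apply: (tpow_lift_cons (f := fun m y => mcons m (tmul y a))).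
split=> [m1 m2 y|m' y1 y2|m' r y]; first exact: mconsDl.
  by rewrite tmulDl mconsDr.
by rewrite mcons_ract tmul_lact.
Qed.

Lemma scale_lact (N : bimodule R) k (x : N) : k *: x = lact (k *: (1 : R)) x.
Proof. by rewrite lactZl lact1. Qed.

Lemma scale_factor_act k a : k *: a = factor_act (k *: (1 : R)) a.
Proof. by apply: factor_ext => i; exact: scale_lact. Qed.

Lemma tmulZl j k (x : tpow M j) a : tmul (k *: x) a = k *: tmul x a.
Proof. by rewrite scale_lact tmul_lact -scale_factor_act. Qed.

Lemma tmul0l j a : tmul (0 : tpow M j) a = 0.
Proof. by rewrite -(scale0r (0 : tpow M j)) tmulZl scale0r. Qed.
Lemma tmul0r j (x : tpow M j) : tmul x 0 = 0.
Proof. by rewrite -(scale0r (0 : A)) tmulZr !scale0r. Qed.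
Lemma mcons0 m : mcons m 0 = 0.
Proof. by rewrite -(scale0r (0 : A)) mconsZr !scale0r. Qed.

Lemma mcons_sum (I : finType) m (F : I -> A) :
  mcons m (\sum_i F i) = \sum_i mcons m (F i).
Proof. by elim/big_rec2: _ => [|i a b _ <-]; rewrite ?mcons0 ?mconsDr. Qed.

Lemma tmul_sum j (I : finType) (x : tpow M j) (F : I -> A) :
  tmul x (\sum_i F i) = \sum_i tmul x (F i).
Proof. by elim/big_rec2: _ => [|i a b _ <-]; rewrite ?tmul0r ?tmulDr. Qed.

Lemma mcons_tinj k m (x : tpow M k) :
  (k.+1 < p.+2)%N -> mcons m (tinj x) = tinj (tcons m x).
Proof.
move=> lt_k; apply: factor_ext => -[[|j] lt_j] /=.
  rewrite [tinj (tcons _ _) _]tinj_neq // [tinj x _]tinj_neq ?tcons0r ?phi0 //=.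
  by rewrite neq_ltn; apply/orP; left; exact: lt_k.
rewrite /tinj /=; case: eqP => [e|ne]; case: eqP => [e'|ne'] //=.
- by case: _ / e e' => e'; rewrite eq_axiomK.
- by case: ne'; rewrite e.
- by case: ne; case: e'.
- by rewrite tcons0r.
Qed.

Lemma mcons_tinj_max m (x : tpow M p.+1) :
  mcons m (tinj x) = @tinj 0 (phi (tcons m x)).
Proof.
apply: factor_ext => -[[|j] lt_j] /=.
  rewrite (tinj_val (i := ord_max)).
  by rewrite -[Ordinal lt_j]/(@Ordinal _ 0 lt_j) (tinj_val (i := Ordinal lt_j)).
rewrite [RHS]tinj_neq // tinj_neq ?tcons0r //=.
by rewrite neq_ltn; apply/orP; right; exact: lt_j.
Qed.

Lemma factor_act_tinj k r (x : tpow M k) : factor_act r (tinj x) = tinj (lact r x).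
Proof.
apply: factor_ext => i; rewrite /factor_act /tinj.
by case: eqP => [e|_]; [case: _ / e | rewrite lact0].
Qed.

Lemma tmul_one k (x : tpow M k) : (k < p.+2)%N -> tmul x factor_one = tinj x.
Proof.
elim: k x => [|k IHk] x lt_k.
  by rewrite /= factor_act_tinj; congr tinj; exact: mulr1.
elim/tpow_ind: x => [|x y hx hy|m x]; first by rewrite tmul0l tinj0.
  by rewrite tmulDl hx hy tinjD.
by rewrite tmul_tcons IHk ?mcons_tinj // ltnW.
Qed.

(* Contracting the first n positions: n-fold left multiplication is phi.      *)
Lemma tmul_phi (u : tpow M p.+2) a : tmul u a = factor_act (phi u) a.
Proof.
rewrite (factor_decomp a); move: (a) => a'.
have: forall k (x : tpow M k), (k < p.+2)%N ->
    forall u : tpow M p.+2, tmul u (tinj x) = factor_act (phi u) (tinj x).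
  move=> {u a a'}; elim=> [|k IHk] x lt_k u.
    elim/tpow_ind: u => [|u v hu hv|m y].
    - rewrite tmul0l phi0; apply: factor_ext => i.
      by rewrite /factor_act lact0l.
    - by rewrite tmulDl hu hv phiD factor_actDl.
    have -> : tinj x = factor_act x factor_one.
      by rewrite factor_act_tinj; congr tinj; exact: (esym (mulr1 _)).
    rewrite -tmul_ract ract_tcons tmul_tcons tmul_one // mcons_tinj_max.
    rewrite -ract_tcons phi_ract -factor_actM factor_act_tinj.
    by congr tinj; exact: (esym (mulr1 _)).
  elim/tpow_ind: x => [|x y hx hy|m' x].
  - rewrite tinj0 tmul0r; apply: factor_ext => i.
    by rewrite /factor_act lact0.
  - by rewrite tinjD tmulDr hx hy factor_actDr.
  rewrite -mcons_tinj //; elim/ptensor_ind: u => [|u v hu hv|w].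
  - rewrite tmul0l phi0; apply: factor_ext => i.
    by rewrite /factor_act lact0l.
  - by rewrite tmulDl hu hv phiD factor_actDl.
  pose w' i := if (i < p.+2)%N then w i else m'.
  rewrite (eq_ptensor (w := w')); last by move=> i; rewrite /w' => ->.
  have <- : w' p.+2 = m' by rewrite /w' ltnn.
  have tmul_snoc j (v : nat -> M) b :
      tmul (ptensor j v) (mcons (v j) b) =
      mcons (v 0) (tmul (ptensor j (fun i => v i.+1)) b).
    elim: j v => [|j IHj] v; first by rewrite /= !factor_act1.
    by rewrite [ptensor _ v]/= tmul_tcons (IHj (fun i => v i.+1)) -tmul_tcons.
  rewrite tmul_snoc IHk ?(ltnW lt_k) // -mcons_ract -mcons_lact.
  by rewrite (assoc_morphism_assoc phi).
move=> H; rewrite tmul_sum [in RHS]/factor_act.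
have -> : (fun i => lact (phi u) ((\sum_i0 tinj (a' i0)) i)) =
          \sum_i factor_act (phi u) (tinj (a' i)) :> A.
  apply: factor_ext => i; rewrite !factor_sumE /factor_act.
  by elim/big_rec2: _ => [|j x y _ <-]; rewrite ?lact0 ?lactD.
by apply: eq_bigr => i _; apply: H; exact: ltn_ord.
Qed.

Lemma factor_mulDl : left_distributive factor_mul +%R.
Proof.
move=> a b c; rewrite -big_split; apply: eq_bigr => i _.
by rewrite factorDE tmulDl.
Qed.
Lemma factor_mulDr : right_distributive factor_mul +%R.
Proof.
by move=> a b c; rewrite -big_split; apply: eq_bigr => i _; rewrite tmulDr.
Qed.

Lemma factor_mulZl k a b : k *: factor_mul a b = factor_mul (k *: a) b.
Proof.
by rewrite scaler_sumr; apply: eq_bigr => i _; rewrite factorZE tmulZl.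
Qed.
Lemma factor_mulZr k a b : k *: factor_mul a b = factor_mul a (k *: b).
Proof. by rewrite scaler_sumr; apply: eq_bigr => i _; rewrite tmulZr. Qed.

Lemma factor_mul_tinj k (x : tpow M k) b :
  (k < p.+2)%N -> factor_mul (tinj x) b = tmul x b.
Proof.
move=> lt_k; rewrite /factor_mul (bigD1 (Ordinal lt_k : 'Z_p.+2)) //= big1.
  by rewrite addr0 (tinj_val (i := Ordinal lt_k)).
move=> i ik; rewrite tinj_neq ?tmul0l //.
by rewrite eq_sym.
Qed.

Lemma factor_mul1 : left_id factor_one factor_mul.
Proof. by move=> a; rewrite factor_mul_tinj //= factor_act1. Qed.
Lemma factor_mulr1 : right_id factor_one factor_mul.
Proof.
move=> a; rewrite [RHS]factor_decomp; apply: eq_bigr => i _.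
by rewrite tmul_one.
Qed.

Lemma factor_act_sum (I : finType) r (F : I -> A) :
  factor_act r (\sum_i F i) = \sum_i factor_act r (F i).
Proof.
elim/big_rec2: _ => [|i a b _ <-]; last exact: factor_actDr.
by apply: factor_ext => j; exact: lact0.
Qed.

Lemma factor_act_mul r a b :
  factor_act r (factor_mul a b) = factor_mul (factor_act r a) b.
Proof.
by rewrite factor_act_sum; apply: eq_bigr => i _; rewrite -tmul_lact.
Qed.

Lemma factor_mul_suml (I : finType) (F : I -> A) b :
  factor_mul (\sum_i F i) b = \sum_i factor_mul (F i) b.
Proof.
elim/big_rec2: _ => [|i a c _ <-]; last exact: factor_mulDl.
by apply: big1 => i _; exact: tmul0l.
Qed.

Lemma mcons_mul m a b : mcons m (factor_mul a b) = factor_mul (mcons m a) b.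
Proof.
have H k (x : tpow M k) : (k < p.+2)%N ->
    tmul (tcons m x) b = factor_mul (mcons m (tinj x)) b.
  move=> lt_k; have [lt_k1|] := ltnP k.+1 p.+2.
    by rewrite mcons_tinj // factor_mul_tinj.
  rewrite ltnS => le_k; have e : p.+1 = k.
    by apply/eqP; rewrite eqn_leq le_k -ltnS lt_k.
  case: _ / e x {lt_k le_k} => x.
  by rewrite mcons_tinj_max factor_mul_tinj // tmul_phi.
rewrite [in RHS](factor_decomp a) mcons_sum factor_mul_suml mcons_sum.
by apply: eq_bigr => i _; rewrite -tmul_tcons H.
Qed.

Lemma tmul_mul k (x : tpow M k) a b :
  tmul x (factor_mul a b) = factor_mul (tmul x a) b.
Proof.
elim: k x => [|k IHk] x; first exact: factor_act_mul.
elim/tpow_ind: x => [|x y hx hy|m x].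
- by rewrite !tmul0l /factor_mul big1 // => i _; exact: tmul0l.
- by rewrite !tmulDl factor_mulDl hx hy.
- by rewrite !tmul_tcons IHk mcons_mul.
Qed.

Lemma factor_mulA : associative factor_mul.
Proof.
move=> a b c; rewrite [factor_mul a b]/factor_mul factor_mul_suml.
by apply: eq_bigr => i _; exact: tmul_mul.
Qed.

Lemma factor_one_neq0 : factor_one != 0.
Proof.
apply/eqP=> /(congr1 (fun a : A => a 0)).
rewrite /factor_one (tinj_val (i := 0)) => /eqP.
by rewrite (oner_eq0 R).
Qed.

HB.instance Definition _ := GRing.Zmodule_isNzRing.Build A
  factor_mulA factor_mul1 factor_mulr1 factor_mulDl factor_mulDr factor_one_neq0.
HB.instance Definition _ := GRing.Lmodule_isLalgebra.Build K A factor_mulZl.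
HB.instance Definition _ := GRing.Lalgebra_isAlgebra.Build K A factor_mulZr.

Lemma finite_dimensional_factor : finite_dimensional A.
Proof.
have fd (i : 'Z_p.+2) := finite_dimensional_tpow i fdM.
pose I i := sval (cid (fd i)); pose b i : I i -> tpow M i :=
  sval (cid (svalP (cid (fd i)))).
have bP i : forall v, exists c : I i -> K, v = \sum_j c j *: b i j.
  exact: (svalP (cid (svalP (cid (fd i))))).
exists {i : 'Z_p.+2 & I i}, (fun ij => tinj (b (tag ij) (tagged ij))) => a.
exists (fun ij => sval (cid (bP (tag ij) (a (tag ij)))) (tagged ij)).
transitivity (\sum_i \sum_(j : I i)
    sval (cid (bP i (a i))) j *: (tinj (b i j) : A)); last first.
  exact: (sig_big_dep _ _
            (fun i j => sval (cid (bP i (a i))) j *: (tinj (b i j) : A))).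
rewrite [LHS]factor_decomp.
apply: eq_bigr => i _; rewrite [in LHS](svalP (cid (bP i (a i)))).
elim/big_rec2: _ => [|j x y _ <-]; first exact: tinj0.
by rewrite tinjD tinjZ.
Qed.

HB.instance Definition _ := Lmodule_hasFinDim.Build K A
  (finite_dimensional_iso finite_dimensional_factor).
HB.instance Definition _ := Algebra_isFalgebra.Build K A.

Lemma factor_mulE a b : a * b = \sum_i tmul (a i) b. Proof. by []. Qed.
Lemma factor_oneE : 1 = @tinj 0 (1 : R). Proof. by []. Qed.

Lemma tmul_ptensor_cat i j (m : nat -> M) a :
  tmul (ptensor i m) (tmul (ptensor j (fun t => m (i + t)%N)) a) =
  tmul (ptensor (i + j) m) a.
Proof.
elim: i m => [|i IHi] m; first exact: factor_act1.
rewrite addSn [ptensor i.+1 m]/= [ptensor (i + j).+1 m]/= !tmul_tcons.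
by rewrite -IHi.
Qed.

(* The product of A(R, M, phi) on pure tensors, for 0 <= i, j < n.            *)
Lemma factor_mul_ptensor_lt i j (m : nat -> M) :
  (i + j < p.+2)%N ->
  tinj (ptensor i m) * tinj (ptensor j (fun t => m (i + t)%N)) =
  tinj (ptensor (i + j) m).
Proof.
move=> lt_ij; rewrite -[RHS]tmul_one // -tmul_ptensor_cat.
rewrite -[tinj (ptensor j _)]tmul_one; last first.
  exact: leq_ltn_trans (leq_addl i j) lt_ij.
by apply: factor_mul_tinj; exact: leq_ltn_trans (leq_addr j i) lt_ij.
Qed.

Lemma factor_mul_ptensor_ge i j k (m : nat -> M) :
  (i < p.+2)%N -> (j < p.+2)%N -> (i + j = p.+2 + k)%N ->
  tinj (ptensor i m) * tinj (ptensor j (fun t => m (i + t)%N)) =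
  tinj (lact (phi (ptensor p.+2 m) : R) (ptensor k (fun t => m (p.+2 + t)%N))).
Proof.
move=> lt_i lt_j ijk; have lt_k : (k < p.+2)%N.
  by rewrite -(ltn_add2l p.+2) -ijk -addSn leq_add // ltnW.
rewrite -[tinj (ptensor j _)]tmul_one // [LHS]factor_mul_tinj //.
by rewrite tmul_ptensor_cat ijk -tmul_ptensor_cat tmul_phi tmul_one ?factor_act_tinj.
Qed.

Definition factor_proj (i : 'Z_p.+2) a : A := tinj (a i).

Lemma factor_proj_linear i : linear (factor_proj i).
Proof. by move=> k a b; rewrite /factor_proj tinjD tinjZ. Qed.

HB.instance Definition _ i :=
  GRing.isLinear.Build K A A *:%R (factor_proj i) (factor_proj_linear i).

Definition factor_grade (i : 'Z_p.+2) : {vspace A} :=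
  limg (linfun (factor_proj i)).

Lemma factor_gradeP i a :
  reflect (forall j, j != i -> a j = 0) (a \in factor_grade i).
Proof.
apply: (iffP memv_imgP) => [[b _ ->] j ji|a0].
  by rewrite lfunE /= /factor_proj tinj_neq // eq_sym.
exists a; first exact: memvf.
rewrite lfunE /= /factor_proj; apply: factor_ext => j.
have [<-|ji] := eqVneq j i; first by rewrite tinj_val.
by rewrite a0 // tinj_neq // eq_sym.
Qed.

End FactorAlgebra.

Section GradedAlgebras.
Variables (K : fieldType) (G : finZmodType) (A : falgType K).
Variable gr : G -> {vspace A}.

Definition is_grading : Prop :=
  [/\ directv (\sum_g gr g), (\sum_g gr g)%VS = fullv, 1 \in gr 0
    & forall g h, (gr g * gr h <= gr (g + h)%R)%VS].

Definition graded_faithful (s : G) : Prop :=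
  forall g a, a \in gr g ->
    (forall b, b \in gr (s - g) -> b * a = 0) -> a = 0.

Definition strongly_graded : Prop :=
  forall g h, (gr g * gr h)%VS = gr (g + h)%R.

Definition dual_grade (g : G) (f : 'Hom(A, K^o)) : Prop :=
  forall h, h != - g -> forall a, a \in gr h -> f a = 0.

(* A^* and A(s) are isomorphic as graded left modules; A(s)_g = A_(g + s).    *)
Definition graded_frobenius (s : G) : Prop :=
  exists theta : dual_bimodule A -> regular_bimodule A,
    [/\ lmodule_hom theta, bijective theta
      & forall g f, dual_grade g f <-> theta f \in gr (g + s)].

End GradedAlgebras.

Definition frobenius (K : fieldType) (B : falgType K) : Prop :=
  lmodule_iso (dual_bimodule B) (regular_bimodule B).

Definition injective_lmodule (B : nzRingType) (Q : lmodType B) : Prop :=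
  forall (X Y : lmodType B) (i : {linear X -> Y}) (f : {linear X -> Q}),
    injective i -> exists g : {linear Y -> Q}, forall x, g (i x) = f x.

Definition quasi_frobenius (K : fieldType) (B : falgType K) : Prop :=
  injective_lmodule (B^o : lmodType B).

Definition invertible_bimodule (K : fieldType) (R : falgType K)
    (M : bimodule R) : Prop :=
  exists N : bimodule R,
    bimodule_iso (tensor M N) (regular_bimodule R) /\
    bimodule_iso (tensor N M) (regular_bimodule R).

Section FactorGrading.
Variables (K : fieldType) (R : falgType K) (M : bimodule R) (p : nat).
Variables (fdM : finite_dimensional M) (phi : assoc_morphism M p.+2).
Local Notation gr := (@factor_grade K R M p fdM phi).

Lemma tinj_grade (i : 'Z_p.+2) (x : tpow M i) : tinj fdM phi x \in gr i.
Proof. by apply/factor_gradeP => j ji; rewrite tinj_neq // eq_sym. Qed.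

Lemma mcons_grade m i (a : factor_alg fdM phi) : a \in gr i -> mcons m a \in gr (i + 1).
Proof.
move/factor_gradeP=> ai; apply/factor_gradeP=> -[[|j] lt_j] ji /=.
  rewrite ai ?tcons0r.
    case: (assoc_morphism_hom phi) => -[L _] _.
    have /eqP := L (-1) 0 0; rewrite scaler0 addr0 scaleN1r addNr.
    by move/eqP.
  apply: contraNneq ji => <-; apply/eqP/val_inj => /=.
  by rewrite (modn_small (m := 1)) // addn1 modnn.
rewrite ai ?tcons0r //; apply: contraNneq ji => <-; apply/eqP/val_inj => /=.
by rewrite (modn_small (m := 1)) // addn1 modn_small.
Qed.

Lemma tmul_grade k (x : tpow M k) i (a : factor_alg fdM phi) :
  a \in gr i -> tmul x a \in gr (k%:R + i).
Proof.
move=> ai; elim: k x => [|k IHk] x.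
  apply/factor_gradeP=> j ji; rewrite /= /factor_act.
  by move/factor_gradeP: ai => -> //; [exact: lact0 | rewrite add0r in ji].
elim/tpow_ind: x => [|x y hx hy|m x].
- by rewrite tmul0l mem0v.
- by rewrite tmulDl memvD.
- by rewrite tmul_tcons -natr1 addrAC; exact: mcons_grade.
Qed.

Lemma factor_is_grading : is_grading gr.
Proof.
split.
- apply/directv_sum_independent => us usP us0 i _; apply: factor_ext => j.
  have [->|ji] := eqVneq j i; last first.
    by have /factor_gradeP := usP i isT; apply.
  have := congr1 (fun a : factor_alg fdM phi => a i) us0.
  rewrite /= factor_sumE (bigD1 i) //= big1 ?addr0 // => k ki.
  by have /factor_gradeP := usP k isT; apply; rewrite eq_sym.
- apply/vspaceP=> a.
  rewrite memvf (factor_decomp a); apply: memv_sumr => i _; exact: tinj_grade.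
- by rewrite factor_oneE; exact: (tinj_grade (i := 0)).
- move=> g h; apply/prodvP=> a b ag bh; rewrite factor_mulE.
  apply: memv_suml => i _; have [->|ig] := eqVneq i g.
    by have := tmul_grade (a g) bh; rewrite natr_Zp.
  by move/factor_gradeP: ag => -> //; rewrite tmul0l mem0v.
Qed.

End FactorGrading.

(* Main.v *)
Require Import Defs.
From HB Require Import structures.
From mathcomp Require Import all_boot all_algebra falgebra.
From mathcomp Require Import boolp.

Set Implicit Arguments.
Unset Strict Implicit.
Unset Printing Implicit Defensive.

Import GRing.Theory.

Local Open Scope ring_scope.

(** For invertible M, all is read off the projection a |-> a_(n-1) of
    A = A(R, M, phi) on its top component, with n = p.+2: a product of elements
    of degrees i and n - 1 - i is a plain concatenation, whatever phi is.
    Below, M^i is the i-th tensor power.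

    Tensoring with an invertible M on the left is an equivalence of left
    R-modules, which has two consequences for concatenation: it is
    faithful in its second argument ([tmul_tinj_eq0]), and each left R-linear
    map from M^i to M^k with i <= k is x |-> x (x) y for a y in M^(k-i)
    ([left_hom_tmul]).  To reach them without tensoring arbitrary modules, the
    two isomorphisms that make M invertible are turned into pairings
    pl : M x N -> R and pr : N x M -> R with pl(m, n) m' = m pr(n, m'), both
    having 1 in the span of their values ([invertible_pairing]).

    The first property makes A (n-1)-faithful.  The two together say that
    b |-> (a |-> (a b)_(n-1)) is an isomorphism from A to the coinduced
    module Hom_R(A, M^(n-1)).  The functor Hom_R(A, -) preserves injectivity,
    and reflects it because R is a direct summand of A as an R-bimodule; so A
    is injective over itself exactly when M^(n-1) is injective over R
    ([injective_coinduced], [injective_of_coinduced]).  The pairings show that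
    M^(n-1) is a left progenerator, hence that it is injective exactly when R
    is ([injective_tpow]), so A is quasi-Frobenius exactly when R is.

    If phi is onto, the products that overflow length n fill their component
    as well, so A is strongly graded ([factor_strongly_graded]); and a strongly
    graded algebra is s-faithful for all s ([strongly_graded_faithful]).

    All Frobenius statements follow from s-faithfulness.  An
    isomorphism f from M^s to R^* yields the linear form x |-> f(x)(1) on the
    component of degree s; when A is s-faithful, the bilinear form sending
    (a, b) to the value of this linear form at (a b)_s is nondegenerate degree
    by degree.  Since A is finite-dimensional, it induces a graded isomorphism
    between A^* and A(s) ([form_graded_frobenius]). *)

(** * Injective modules and retracts *)

Section InjectiveModules.

Definition linear_pack (B : nzRingType) (U V : lmodType B) (f : U -> V)
    (fL : linear f) : {linear U -> V} :=
  HB.pack f (GRing.isLinear.Build B U V *:%R f fL).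

(** The hypothesis presents P as a retract of a finite power of Q.  Extending
    along i one coordinate at a time avoids forming that power. *)
Lemma injective_retract (B : nzRingType) (P Q : lmodType B) (I : Type)
    (s : seq I) (al : I -> {linear P -> Q}) (be : I -> {linear Q -> P}) :
  (forall x, x = \sum_(i <- s) be i (al i x)) ->
  injective_lmodule Q -> injective_lmodule P.
Proof.
move=> idP injQ X Y i f i_inj.
have ext j : {g : {linear Y -> Q} | forall x, g (i x) = al j (f x)}.
  exact/cid/(injQ X Y i (al j \o f) i_inj).
have gL : linear (fun y => \sum_(j <- s) be j (sval (ext j) y)).
  move=> b u v; rewrite scaler_sumr -big_split; apply: eq_bigr => j _.
  by rewrite !linearP.
exists (linear_pack gL) => x /=; rewrite [RHS]idP; apply: eq_bigr => j _.
by rewrite (svalP (ext j)).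
Qed.

End InjectiveModules.

(** * Restriction and coinduction along a ring morphism *)

Section Coinduction.
Variables (R A : nzRingType) (j : {rmorphism R -> A}).

(** The morphism is a phantom argument: it lets the R-module structure below be
    inferred from the type. *)
Definition restriction of {rmorphism R -> A} := fun X : lmodType A => X : Type.

Section Restriction.
Variable X : lmodType A.
Local Notation X_R := (restriction j X).

HB.instance Definition _ := GRing.Zmodule.on X_R.

Definition restriction_scale (r : R) (x : X_R) : X_R := j r *: (x : X).

Lemma restriction_scaleA r s x :
  restriction_scale r (restriction_scale s x) = restriction_scale (r * s) x.
Proof. by rewrite /restriction_scale scalerA rmorphM. Qed.
Lemma restriction_scale1 : left_id 1 restriction_scale.
Proof. by move=> x; rewrite /restriction_scale rmorph1 scale1r. Qed.
Lemma restriction_scaleDr : right_distributive restriction_scale +%R.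
Proof. by move=> r x y; exact: scalerDr. Qed.
Lemma restriction_scaleDl x : {morph restriction_scale^~ x : r s / r + s}.
Proof. by move=> r s; rewrite /restriction_scale rmorphD scalerDl. Qed.

HB.instance Definition _ := GRing.Zmodule_isLmodule.Build R X_R
  restriction_scaleA restriction_scale1 restriction_scaleDr restriction_scaleDl.

Lemma restriction_scaleE r (x : X_R) : r *: x = j r *: (x : X) :> X.
Proof. by []. Qed.

End Restriction.

Section Coinduced.
Variable Y : lmodType R.

Local Obligation Tactic := idtac.

(** Hom_R(A, Y), on which c in A acts by (c F)(a) = F(a c). *)
Record coinduced := Coinduced {
  coinduced_fun :> A -> Y;
  coinducedD : {morph coinduced_fun : a b / a + b};
  coinducedZ : forall r a, coinduced_fun (j r * a) = r *: coinduced_fun a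
}.

HB.instance Definition _ := gen_eqMixin coinduced.
HB.instance Definition _ := gen_choiceMixin coinduced.

Lemma coinduced_ext (F G : coinduced) : F =1 G -> F = G.
Proof.
case: F G => [F FD FZ] [G GD GZ] /= /funext FG; case: _ / FG in GD GZ *.
by congr Coinduced; exact: Prop_irrelevance.
Qed.

Program Definition coinduced_zero := @Coinduced (fun=> 0) _ _.
Next Obligation. by move=> a b /=; rewrite addr0. Qed.
Next Obligation. by move=> r a; rewrite scaler0. Qed.

Program Definition coinduced_opp (F : coinduced) :=
  @Coinduced (fun a => - F a) _ _.
Next Obligation. by move=> F a b; rewrite /= coinducedD opprD. Qed.
Next Obligation. by move=> F r a; rewrite /= coinducedZ scalerN. Qed.

Program Definition coinduced_add (F G : coinduced) :=
  @Coinduced (fun a => F a + G a) _ _.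
Next Obligation. by move=> F G a b; rewrite /= !coinducedD addrACA. Qed.
Next Obligation. by move=> F G r a; rewrite /= !coinducedZ scalerDr. Qed.

Program Definition coinduced_scale (c : A) (F : coinduced) :=
  @Coinduced (fun a => F (a * c)) _ _.
Next Obligation. by move=> c F a b; rewrite /= mulrDl coinducedD. Qed.
Next Obligation. by move=> c F r a; rewrite /= -mulrA coinducedZ. Qed.

Lemma coinduced_addA : associative coinduced_add.
Proof. by move=> F G H; apply: coinduced_ext => a; exact: addrA. Qed.
Lemma coinduced_addC : commutative coinduced_add.
Proof. by move=> F G; apply: coinduced_ext => a; exact: addrC. Qed.
Lemma coinduced_add0 : left_id coinduced_zero coinduced_add.
Proof. by move=> F; apply: coinduced_ext => a; exact: add0r. Qed.
Lemma coinduced_addN : left_inverse coinduced_zero coinduced_opp coinduced_add.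
Proof. by move=> F; apply: coinduced_ext => a; exact: addNr. Qed.

HB.instance Definition _ := GRing.isZmodule.Build coinduced
  coinduced_addA coinduced_addC coinduced_add0 coinduced_addN.

Lemma coinduced_scaleA c d F :
  coinduced_scale c (coinduced_scale d F) = coinduced_scale (c * d) F.
Proof. by apply: coinduced_ext => a /=; rewrite mulrA. Qed.
Lemma coinduced_scale1 : left_id 1 coinduced_scale.
Proof. by move=> F; apply: coinduced_ext => a /=; rewrite mulr1. Qed.
Lemma coinduced_scaleDr : right_distributive coinduced_scale +%R.
Proof. by move=> c F G; apply: coinduced_ext. Qed.
Lemma coinduced_scaleDl F : {morph coinduced_scale^~ F : c d / c + d}.
Proof.
by move=> c d; apply: coinduced_ext => a /=; rewrite mulrDr coinducedD.
Qed.

HB.instance Definition _ := GRing.Zmodule_isLmodule.Build A coinduced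
  coinduced_scaleA coinduced_scale1 coinduced_scaleDr coinduced_scaleDl.

Lemma coinduced_linE c (F G : coinduced) a : (c *: F + G) a = F (a * c) + G a.
Proof. by []. Qed.

End Coinduced.

(** In this section b |-> (a |-> pi(a b)) identifies A with Hom_R(A, Q). *)
Section FrobeniusForm.
Variables (Q : lmodType R) (pi : A -> Q).
Hypothesis piD : {morph pi : a b / a + b}.
Hypothesis piZ : forall r a, pi (j r * a) = r *: pi a.
Hypothesis pi_repr : forall G : A -> Q,
  {morph G : a b / a + b} -> (forall r a, G (j r * a) = r *: G a) ->
  exists b, forall a, G a = pi (a * b).
Hypothesis pi_inj : forall b, (forall a, pi (a * b) = 0) -> b = 0.

Lemma pi_inj2 b c : (forall a, pi (a * b) = pi (a * c)) -> b = c.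
Proof.
move=> bc; apply/eqP; rewrite -subr_eq0; apply/eqP/pi_inj => a.
have /(congr1 (fun q => q - pi (a * c))) := piD (a * (b - c)) (a * c).
by rewrite -mulrDr subrK bc addrK subrr.
Qed.

(** Coinduction is right adjoint to restriction: an A-linear map f into
    Hom_R(A, Q) is determined by the R-linear map pi o f.  That map is extended
    by injectivity of Q, and the extension is turned back into an A-linear map
    through [pi_repr]. *)
Lemma injective_coinduced :
  injective_lmodule Q -> injective_lmodule (A^o : lmodType A).
Proof.
move=> injQ X Y i f i_inj.
have fL : linear (fun x : restriction j X => pi (f x)).
  move=> r x y; rewrite -piZ -piD; congr pi.
  by rewrite restriction_scaleE linearP.
have iL : linear (i : restriction j X -> restriction j Y).
  by move=> r x y; rewrite [LHS](linearP i).
have [g0 g0P] := injQ _ _ (linear_pack iL) (linear_pack fL) i_inj.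
have /choice[rep repP] (y : Y) : exists b, forall a, g0 (a *: y) = pi (a * b).
  apply: pi_repr => [a b|r a]; first by rewrite scalerDl; exact: raddfD.
  by rewrite -scalerA; exact: (linearZ_LR g0).
have gL : linear (rep : Y -> A^o).
  move=> c x y; apply: pi_inj2 => a; rewrite -repP scalerDr scalerA.
  transitivity (g0 ((a * c) *: x) + g0 (a *: y)); first exact: raddfD.
  by rewrite !repP -piD mulrDr mulrA.
exists (linear_pack gL) => x; apply: pi_inj2 => a /=.
rewrite -repP -linearZ_LR [LHS]g0P /=; congr pi; exact: linearZ_LR.
Qed.

(** Given f : X -> Q, the map Hom_R(A, f) has values in A, so it extends to
    Hom_R(A, Y).  The retraction eps embeds Y into Hom_R(A, Y) by sending y to
    a |-> eps(a) y, and evaluation at 1 leads from Hom_R(A, Q) back to Q; the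
    composite extends f. *)
Lemma injective_of_coinduced (eps : A -> R) :
  {morph eps : a b / a + b} -> (forall r a, eps (j r * a) = r * eps a) ->
  (forall r a, eps (a * j r) = eps a * r) -> eps 1 = 1 ->
  injective_lmodule (A^o : lmodType A) -> injective_lmodule Q.
Proof.
move=> epsD epsZl epsZr eps1 injA X Y i f i_inj.
have post_proof (V W : lmodType R) (u : {linear V -> W}) (F : coinduced V) :
    {morph u \o F : a b / a + b} /\
    forall r a, (u \o F) (j r * a) = r *: (u \o F) a.
  split=> [a b|r a] /=; first by rewrite coinducedD linearD.
  by rewrite coinducedZ linearZ_LR.
pose post (V W : lmodType R) (u : {linear V -> W}) (F : coinduced V) :=
  Coinduced (post_proof V W u F).1 (post_proof V W u F).2.
have iL : linear (post X Y i).
  by move=> c F G; apply: coinduced_ext => a /=; rewrite linearD.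
have post_inj : injective (linear_pack iL).
  move=> F G FG; apply: coinduced_ext => a; apply: i_inj.
  exact: (congr1 (fun H : coinduced Y => H a) FG).
have /choice[rep repP] (F : coinduced X) :
    exists b, forall a, f (F a) = pi (a * b).
  apply: pi_repr => [a b|r a]; first by rewrite coinducedD linearD.
  by rewrite coinducedZ linearZ_LR.
have repL : linear (rep : coinduced X -> A^o).
  move=> c F G; apply: pi_inj2 => a; rewrite -repP coinduced_linE linearD.
  by rewrite !repP -piD mulrDr mulrA.
have [g gP] := injA _ _ (linear_pack iL) (linear_pack repL) post_inj.
have iotaD (V : lmodType R) (v : V) :
    {morph (fun a => eps a *: v) : a b / a + b}.
  by move=> a b; rewrite epsD scalerDl.
have iotaZ (V : lmodType R) (v : V) r a :
    eps (j r * a) *: v = r *: (eps a *: v).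
  by rewrite epsZl scalerA.
pose iota (V : lmodType R) (v : V) := Coinduced (iotaD V v) (iotaZ V v).
have hL : linear (fun y => pi (g (iota Y y))).
  move=> r y z; rewrite -piZ -piD; congr pi.
  transitivity (g (j r *: iota Y y + iota Y z)); last exact: linearP.
  by congr (g _); apply: coinduced_ext => a /=; rewrite epsZr scalerDr scalerA.
exists (linear_pack hL) => x /=.
have -> : iota Y (i x) = linear_pack iL (iota X x).
  by apply: coinduced_ext => a /=; rewrite linearZ_LR.
by rewrite gP /= -[rep _]mul1r -repP /= eps1 scale1r.
Qed.

End FrobeniusForm.
End Coinduction.

(** * Bimodules as left modules *)

Section LeftModule.
Variables (K : fieldType) (R : falgType K) (M : bimodule R).

(** The type M carries a K-module structure already; this alias carries the
    one over R. *)
Definition left_module : Type := M.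

HB.instance Definition _ := GRing.Zmodule.on left_module.

Let left_scaleA r s (m : left_module) :
  lact r (lact s (m : M)) = lact (r * s) (m : M) :> left_module.
Proof. by rewrite lactA. Qed.
Let left_scaleDr : right_distributive (@lact K R M) +%R.
Proof. by move=> r m n; exact: lactD. Qed.
Let left_scaleDl (m : M) : {morph (@lact K R M)^~ m : r s / r + s}.
Proof. by move=> r s; exact: lactDl. Qed.

HB.instance Definition _ := GRing.Zmodule_isLmodule.Build R left_module
  left_scaleA (@lact1 K R M) left_scaleDr left_scaleDl.

Lemma left_scaleE r (m : left_module) : r *: m = lact r (m : M) :> M.
Proof. by []. Qed.

End LeftModule.

Section BimoduleSums.
Variables (K : fieldType) (R : falgType K) (M : bimodule R).
Variables (I : Type) (s : seq I).

Lemma lact_suml (F : I -> R) (m : M) :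
  lact (\sum_(i <- s) F i) m = \sum_(i <- s) lact (F i) m.
Proof. exact: (raddf_sum (lact_val m)). Qed.
Lemma ract_sumr (m : M) (F : I -> R) :
  ract m (\sum_(i <- s) F i) = \sum_(i <- s) ract m (F i).
Proof. exact: (raddf_sum (ract_val m)). Qed.
End BimoduleSums.

(** * Invertible bimodules *)

Section MoritaPairing.
Variables (K : fieldType) (R : falgType K).
Implicit Types M N : bimodule R.

(** Half of a Morita context relating R to itself: one of the two mixed
    associativity laws.  As left module, M is a generator by the family for pl,
    and finitely generated projective by the family for pr. *)
Record morita_pairing M N (pl : M -> N -> R) (pr : N -> M -> R) : Prop := {
  mpairDl : forall x y n, pl (x + y) n = pl x n + pl y n;
  mpairZl : forall r x n, pl (lact r x) n = r * pl x n;
  mpairDr : forall n x y, pr n (x + y) = pr n x + pr n y;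
  mpairZr : forall n x r, pr n (ract x r) = pr n x * r;
  mpairA : forall x n y, lact (pl x n) y = ract x (pr n y);
  mpair1l : exists s : seq (M * N), \sum_(e <- s) pl e.1 e.2 = 1;
  mpair1r : exists s : seq (N * M), \sum_(e <- s) pr e.1 e.2 = 1
}.

Lemma regular_iso_pure M N (f : tensor M N -> regular_bimodule R) :
  bimodule_hom f -> bijective f ->
  exists s : seq (M * N), \sum_(e <- s) f (pure e.1 e.2) = 1 :> R.
Proof.
move=> [[fL _] _] [f' _ f'K].
have fD : {morph f : u v / u + v}.
  by move=> u v; rewrite -[u]scale1r fL !scale1r.
have f0 : f 0 = 0 by apply: (addrI (f 0)); rewrite -fD !addr0.
exists (repr (f' 1)); rewrite -[RHS]f'K -{2}[f' 1]treprK tclassE.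
by rewrite (big_morph f fD f0).
Qed.

(** Isomorphisms f : M (x) N -> R and g : N (x) M -> R need not be compatible:
    m (x) n (x) m' |-> f(m (x) n) m' and m g(n (x) m') differ by an automorphism
    h of M.  Here h is obtained by contracting with the central element
    g^-1(1), and pl is f corrected by a right inverse of h. *)
Lemma invertible_pairing M : invertible_bimodule M ->
  exists N (pl : M -> N -> R) (pr : N -> M -> R), morita_pairing pl pr.
Proof.
move=> [N [[f fH f_bij] [g gH g_bij]]]; exists N.
have [s s1] := regular_iso_pure fH f_bij.
have [t t1] := regular_iso_pure gH g_bij.
case: g_bij fH gH => g' gK g'K [[fL fZ] fR] [[gL gZ] gR].
have fD : {morph f : u v / u + v}.
  by move=> u v; rewrite -[u]scale1r fL !scale1r.
have gD : {morph g : u v / u + v}.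
  by move=> u v; rewrite -[u]scale1r gL !scale1r.
(* the map m (x) n (x) m' |-> f(m (x) n) m' with its first factor fixed to x *)
pose F x : tensor N M -> M := tensor_lift (fun n m => lact (f (pure x n)) m).
have Fbal x : balanced (fun (n : N) (m : M) => lact (f (pure x n)) m).
  split=> [n1 n2 m|n m1 m2|n r m]; first by rewrite /pure tpureDr fD lactDl.
    exact: lactD.
  by rewrite -lactA -[_ * r]fR /= tract_pure.
have Fpure x n m : F x (pure n m) = lact (f (pure x n)) m.
  exact: (tensor_lift_pure (Fbal x)).
have FD x : {morph F x : u v / u + v} by exact: (tensor_liftD (Fbal x)).
have F0 x : F x 0 = 0 by apply: (addrI (F x 0)); rewrite -FD !addr0.
have F_ract x r u : F (ract x r) u = F x (lact r u).
  elim/tensor_ind: u => [|u v hu hv|n m]; first by rewrite lact0 !F0.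
    by rewrite lactD !FD hu hv.
  by rewrite /= tlact_pure !Fpure /pure tpure_bal.
have F_ractr x r u : F x (ract u r) = ract (F x u) r.
  elim/tensor_ind: u => [|u v hu hv|n m]; first by rewrite ract0l F0 ract0l.
    by rewrite ractDl !FD hu hv ractDl.
  by rewrite /= tract_pure !Fpure lract.
have F_add x y u : F (x + y) u = F x u + F y u.
  elim/tensor_ind: u => [|u v hu hv|n m]; first by rewrite !F0 addr0.
    by rewrite !FD hu hv addrACA.
  by rewrite !Fpure /pure tpureDl fD lactDl.
have F_lact r x u : F (lact r x) u = lact r (F x u).
  elim/tensor_ind: u => [|u v hu hv|n m]; first by rewrite !F0 lact0.
    by rewrite !FD hu hv lactD.
  by rewrite !Fpure /pure -tlact_pure fZ lactA.
pose h x := F x (g' 1).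
have g_inj : injective g by exact: can_inj gK.
have hg x u : ract (h x) (g u) = F x u.
  rewrite -F_ractr; congr (F x _); apply: g_inj.
  by rewrite gR g'K; exact: mul1r.
have hr x u : h (ract x (g u)) = F x u.
  rewrite /h F_ract; congr (F x _); apply: g_inj.
  by rewrite gZ g'K; exact: mulr1.
(* the additivity and linearity of pl are tested after acting on M *)
have M_faithful (r r' : R) : (forall m : M, lact r m = lact r' m) -> r = r'.
  move=> rr'; rewrite -[r]mulr1 -[r']mulr1 -s1 !mulr_sumr.
  have fM (q : R) u : q * f u = f (lact q u) by rewrite fZ.
  by apply: eq_bigr => e _; rewrite !fM /= !tlact_pure rr'.
(* by hr, h maps e.1 g(e.2 (x) x) to f(e.1 (x) e.2) x, and these sum to x *)
pose h' x := \sum_(e <- s) ract e.1 (g (pure e.2 x)).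
have h'K x : h (h' x) = x.
  have hD y z : h (y + z) = h y + h z by exact: F_add.
  have h0 : h 0 = 0 by apply: (addrI (h 0)); rewrite -hD !addr0.
  rewrite (big_morph h hD h0) -[RHS]lact1 -s1 lact_suml.
  by apply: eq_bigr => e _; rewrite hr Fpure.
pose pl x n : R := f (pure (h' x) n); pose pr n x : R := g (pure n x).
have plE x n y : lact (pl x n) y = ract x (pr n y).
  by rewrite /pl -Fpure -hg h'K.
exists pl, pr; split=> //.
- by move=> x y n; apply: M_faithful => m; rewrite lactDl !plE ractDl.
- by move=> r x n; apply: M_faithful => m; rewrite lactA !plE lract.
- by move=> n x y; rewrite /pr /pure tpureDr gD.
- by move=> n x r; rewrite -[RHS]gR /= tract_pure.
- exists [seq (h e.1, e.2) | e <- s]; rewrite big_map -[RHS]s1.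
  apply: eq_bigr => e _; apply: M_faithful => m.
  by rewrite plE hg Fpure.
- by exists t.
Qed.

End MoritaPairing.

(** * Tensor powers of an invertible bimodule *)

Section TensorPowerHoms.
Variables (K : fieldType) (R : falgType K) (M N : bimodule R).
Variables (pl : M -> N -> R) (pr : N -> M -> R).
Hypothesis pairing : morita_pairing pl pr.
Local Notation T k := (left_module (tpow M k)).

Lemma tcons_sumr k m (I : Type) (s : seq I) (F : I -> tpow M k) :
  tcons m (\sum_(i <- s) F i) = \sum_(i <- s) tcons m (F i).
Proof. exact: (big_morph _ (tconsDr m) (tcons0r k m)). Qed.

Lemma tcons_suml k (x : tpow M k) (I : Type) (s : seq I) (F : I -> M) :
  tcons (\sum_(i <- s) F i) x = \sum_(i <- s) tcons (F i) x.
Proof.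
have D : {morph (fun m : M => tcons m x) : m1 m2 / m1 + m2}.
  by move=> m1 m2; exact: tconsDl.
have Z : tcons (0 : M) x = 0 by rewrite -(scale0r (0 : M)) tconsZl scale0r.
exact: (big_morph _ D Z).
Qed.

Lemma mpair0l n : pl 0 n = 0.
Proof. by apply: (addrI (pl 0 n)); rewrite -(mpairDl pairing) !addr0. Qed.

(** The action of n in N = M^-1, which undoes one factor M on the left. *)
Definition contract k (n : N) : tpow M k.+1 -> tpow M k :=
  tpow_lift (fun m x => lact (pr n m) x).

Lemma contract_bal k n : balanced (fun m (x : tpow M k) => lact (pr n m) x).
Proof.
split=> [m1 m2 x|m x y|m r x]; first by rewrite (mpairDr pairing) lactDl.
  exact: lactD.
by rewrite (mpairZr pairing) lactA.
Qed.

Lemma contract_tcons k n m (x : tpow M k) :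
  contract n (tcons m x) = lact (pr n m) x.
Proof. exact: (tpow_lift_cons m x (contract_bal k n)). Qed.

Lemma contractD k n : {morph @contract k n : u v / u + v}.
Proof. exact: (tpow_liftD (contract_bal k n)). Qed.

Lemma contract0 k n : contract n (0 : tpow M k.+1) = 0.
Proof. by apply: (addrI (contract n 0)); rewrite -contractD !addr0. Qed.

(** The exchange law behind everything in this part: contracting by n and then
    tensoring with m is acting by pl(m, n), by associativity of the pairings. *)
Lemma tcons_contract k m n (w : tpow M k.+1) :
  tcons m (contract n w) = lact (pl m n) w.
Proof.
elim/tpow_ind: w => [|u v hu hv|m' x]; first by rewrite contract0 tcons0r lact0.
  by rewrite contractD tconsDr hu hv lactD.
by rewrite contract_tcons -tcons_lr lact_tcons (mpairA pairing).
Qed.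

Lemma tcons_separates k (x y : tpow M k) :
  (forall m, tcons m x = tcons m y) -> x = y.
Proof.
move=> xy; have [s s1] := mpair1r pairing.
rewrite -[x]lact1 -[y]lact1 -s1 !lact_suml; apply: eq_bigr => e _.
by rewrite -!contract_tcons xy.
Qed.

(** The functor M (x) - is full.  The preimage of F contracts the values of F
    against a family with 1 = sum pr(n, m); the exchange law moves the scalars
    pl(m', n) through F. *)
Lemma hom_tcons k l (F : {linear T k.+1 -> T l.+1}) :
  exists F' : {linear T k -> T l}, forall m x, F (tcons m x) = tcons m (F' x).
Proof.
have [s s1] := mpair1r pairing.
pose F' (x : tpow M k) : tpow M l :=
  \sum_(e <- s) contract e.1 (F (tcons e.2 x)).
have FZ r (u : tpow M k.+1) : F (lact r u) = lact r (F u).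
  exact: (linearZ_LR F).
have F'E m x : F (tcons m x) = tcons m (F' x).
  rewrite tcons_sumr -[m in LHS]ract1 -s1 ract_sumr tcons_suml.
  rewrite (raddf_sum F); apply: eq_bigr => e _.
  by rewrite tcons_contract -(mpairA pairing) -lact_tcons; exact: FZ.
have F'L : linear (F' : T k -> T l).
  move=> r x y; apply: tcons_separates => m; rewrite -F'E tconsDr.
  transitivity (F (tcons (ract m r) x) + F (tcons m y)).
    rewrite tcons_lr -(raddfD F); congr (F _); exact: tconsDr.
  by rewrite !F'E tcons_lr -tconsDr.
by exists (linear_pack F'L).
Qed.

(** Functionals on M^(k+1) for the two lemmas that follow: apply al to the right
    factor, absorb the resulting scalar in m, and pair with n. *)
Lemma functional_tcons k (al : {linear T k -> R^o}) (n : N) :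
  exists be : {linear T k.+1 -> R^o},
    forall m x, be (tcons m x) = pl (ract m (al x)) n.
Proof.
pose f m (x : tpow M k) := pl (ract m (al x)) n.
have fbal : balanced f.
  split=> [m1 m2 x|m x y|m r x].
  - by rewrite /f ractDl (mpairDl pairing).
  - rewrite /f -(mpairDl pairing) -ractD; congr (pl (ract m _) n).
    exact: raddfD.
  - rewrite /f -ractA; congr (pl (ract m _) n).
    by apply: esym; exact: (linearZ_LR al).
pose be := tpow_lift f.
have beD : {morph be : u v / u + v} by exact: tpow_liftD.
have be0 : be 0 = 0 by apply: (addrI (be 0)); rewrite -beD !addr0.
have bec m x : be (tcons m x) = f m x by exact: tpow_lift_cons.
have beL : linear (be : T k.+1 -> R^o).
  move=> r u v; rewrite beD; congr (_ + _); rewrite left_scaleE.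
  elim/tpow_ind: u => [|u w hu hw|m x]; first by rewrite lact0 be0 scaler0.
    by rewrite lactD !beD hu hw scalerDr.
  by rewrite lact_tcons !bec /f -lract (mpairZl pairing).
by exists (linear_pack beL) => m x; exact: bec.
Qed.

(** A dual basis: M^k is a finitely generated projective left module. *)
Lemma tpow_dual_basis k :
  exists (I : Type) (s : seq I) (al : I -> {linear T k -> R^o})
         (u : I -> tpow M k),
    forall x : tpow M k, x = \sum_(i <- s) lact (al i x) (u i).
Proof.
elim: k => [|k [I [s [al [u xE]]]]].
  exists unit, [:: tt], (fun=> idfun), (fun=> 1 : R) => x.
  by rewrite big_seq1 /= mulr1.
have [t t1] := mpair1r pairing.
have [be beE] :=
  choice (fun ie : I * (N * M) => functional_tcons (al ie.1) ie.2.1).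
exists (I * (N * M))%type, [seq (i, e) | i <- s, e <- t], be.
exists (fun ie => tcons ie.2.2 (u ie.1)).
elim/tpow_ind=> [|x y hx hy|m x].
- by rewrite big1 // => ie _; rewrite [be ie 0]linear0 lact0l.
- rewrite [in LHS]hx [in LHS]hy -big_split; apply: eq_bigr => ie _.
  by rewrite /= -lactDl; congr (lact _ _); apply: esym; exact: raddfD.
rewrite big_allpairs [in LHS](xE x) tcons_sumr; apply: eq_bigr => i _.
rewrite -tcons_lr -[ract m _ in LHS]ract1 -t1 ract_sumr tcons_suml.
by apply: eq_bigr => e _; rewrite beE -(mpairA pairing) lact_tcons.
Qed.

(** The trace ideal contains 1: M^k is a generator of left modules. *)
Lemma tpow_generator k :
  exists (I : Type) (s : seq I) (al : I -> {linear T k -> R^o})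
         (u : I -> tpow M k),
    \sum_(i <- s) al i (u i) = 1 :> R.
Proof.
elim: k => [|k [I [s [al [u u1]]]]].
  exists unit, [:: tt], (fun=> idfun), (fun=> 1 : R).
  by rewrite big_seq1.
have [t t1] := mpair1l pairing.
have [be beE] :=
  choice (fun ie : I * (M * N) => functional_tcons (al ie.1) ie.2.2).
exists (I * (M * N))%type, [seq (i, e) | e <- t, i <- s], be.
exists (fun ie => tcons ie.2.1 (u ie.1)).
rewrite big_allpairs_dep -[RHS]t1; apply: eq_bigr => e _.
rewrite -[e.1 in RHS]ract1 -u1 ract_sumr.
have plD x y : pl (x + y) e.2 = pl x e.2 + pl y e.2 by exact: (mpairDl pairing).
rewrite (big_morph (pl^~ e.2) plD (mpair0l e.2)).
by apply: eq_bigr => i _; rewrite beE.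
Qed.

Lemma scale_linear (Q : bimodule R) (u : Q) :
  linear (fun r : R^o => lact r u : left_module Q).
Proof. by move=> r a b; rewrite lactDl lactA. Qed.

(** M^k is a retract of a power of R by the dual basis, and R is a retract of a
    power of M^k by the generator property. *)
Lemma injective_tpow k :
  quasi_frobenius R <-> injective_lmodule (T k).
Proof.
split=> [injR|injT].
  have [I [s [al [u xE]]]] := tpow_dual_basis k.
  by apply: (injective_retract (s := s) (al := al)
    (be := fun i => linear_pack (scale_linear (u i)))) injR => x /=; exact: xE.
have [I [s [al [u u1]]]] := tpow_generator k.
apply: (injective_retract (s := s) (be := al)
  (al := fun i => linear_pack (scale_linear (u i)))) injT => r /=.
rewrite -[LHS]mulr1 -u1 mulr_sumr; apply: eq_bigr => i _.
by apply: esym; exact: (linearZ_LR (al i)).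
Qed.

End TensorPowerHoms.

(** * Graded algebras *)

Section GradedAlgebraTheory.
Variables (K : fieldType) (G : finZmodType) (A : falgType K).
Variable gr : G -> {vspace A}.

(** If A_(s-g) a = 0, then A_(g-s) A_(s-g) = A_0 kills a, and 1 is in A_0. *)
Lemma strongly_graded_faithful s :
  is_grading gr -> strongly_graded gr -> graded_faithful gr s.
Proof.
move=> [_ _ gr1 _] sg g a ag a0.
have: 1 \in (gr (g - s) * gr (s - g))%VS by rewrite sg subrKA subrr.
have: (gr (g - s) * gr (s - g) <= lker (amulr a))%VS.
  apply/prodvP=> x y _ ys; rewrite memv_ker lfunE /= -mulrA a0 //.
  by rewrite mulr0.
by move/subvP=> sub /sub; rewrite memv_ker lfunE /= mul1r => /eqP.
Qed.

Lemma graded_frobenius_frobenius s : graded_frobenius gr s -> frobenius A.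
Proof. by move=> [theta [thetaL theta_bij _]]; exists theta. Qed.

End GradedAlgebraTheory.

(** * Homogeneous components of A(R, M, phi) *)

Section Factor.
Variables (K : fieldType) (R : falgType K) (M : bimodule R) (p : nat).
Variables (fdM : finite_dimensional M) (phi : assoc_morphism M p.+2).

Local Notation A := (factor_alg fdM phi).
Local Notation gr := (@factor_grade K R M p fdM phi).
Local Notation tinj := (@tinj K R M p fdM phi _).
Local Notation tmul := (@tmul K R M p fdM phi _).
Implicit Types (a b c : A) (g h : 'Z_p.+2).

Lemma tinj_inj k : (k < p.+2)%N -> injective (fun x : tpow M k => tinj x).
Proof.
move=> lt_k x y /(congr1 (fun a : A => a (Ordinal lt_k))).
by rewrite !(tinj_val fdM phi (i := Ordinal lt_k)).
Qed.

Lemma natr_ord k (lt_k : (k < p.+2)%N) : k%:R = Ordinal lt_k :> 'Z_p.+2.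
Proof. exact: (natr_Zp (Ordinal lt_k : 'Z_p.+2)). Qed.

Lemma tinj_natr_grade k (x : tpow M k) : (k < p.+2)%N -> tinj x \in gr k%:R.
Proof.
move=> lt_k; rewrite (natr_ord lt_k).
exact: (tinj_grade fdM phi (i := Ordinal lt_k)).
Qed.

Lemma grade_tinj g a : a \in gr g -> a = tinj (a g).
Proof.
move/factor_gradeP=> ag; apply: factor_ext => i.
have [->|ig] := eqVneq i g; first by rewrite tinj_val.
by rewrite ag // tinj_neq // eq_sym.
Qed.

(** Only one homogeneous component of the right factor contributes to a given
    component of a product. *)
Lemma tmul_component k (x : tpow M k) a g i :
  k%:R + g = i -> tmul x a i = tmul x (tinj (a g)) i.
Proof.
move=> <-; rewrite [in LHS](factor_decomp a) tmul_sum factor_sumE (bigD1 g) //=.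
rewrite big1 ?addr0 // => h hg.
have /factor_gradeP -> // := tmul_grade x (tinj_grade fdM phi (a h)).
by rewrite (inj_eq (addrI _)) eq_sym.
Qed.

Lemma factor_mul_component g h a b :
  a \in gr g -> (a * b) (g + h) = (a * tinj (b h)) (g + h).
Proof.
move=> /grade_tinj ->; rewrite ![tinj (a g) * _]factor_mul_tinj //.
by apply: tmul_component; rewrite natr_Zp.
Qed.

Lemma factor_grade_eq0 g a : a \in gr g -> a g = 0 -> a = 0.
Proof. by move=> /grade_tinj -> ; rewrite tinj_val => ->; rewrite tinj0. Qed.

Lemma factor_gradeM g h a b : a \in gr g -> b \in gr h -> a * b \in gr (g + h).
Proof.
have [_ _ _ grM] := factor_is_grading fdM phi => ag bh.
exact: (subvP (grM g h)) (memv_mul ag bh).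
Qed.

Definition scalar_inj (r : R) : A := tinj (r : tpow M 0).

Lemma scalar_injE r a : scalar_inj r * a = factor_act r a.
Proof. by rewrite [LHS]factor_mul_tinj. Qed.

Lemma scalar_inj_zmod : zmod_morphism scalar_inj.
Proof.
move=> r s; rewrite /scalar_inj -[- s]scaleN1r.
by rewrite [LHS]tinjD [X in _ + X]tinjZ scaleN1r.
Qed.

Lemma scalar_inj_monoid : monoid_morphism scalar_inj.
Proof.
by split=> // r s; rewrite scalar_injE factor_act_tinj.
Qed.

HB.instance Definition _ :=
  GRing.isZmodMorphism.Build R A scalar_inj scalar_inj_zmod.
HB.instance Definition _ :=
  GRing.isMonoidMorphism.Build R A scalar_inj scalar_inj_monoid.

Lemma mul_scalar_inj a r : a * scalar_inj r = (fun i => ract (a i) r).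
Proof.
rewrite [RHS](factor_decomp (fdM := fdM) (phi := phi)) [LHS]factor_mulE.
apply: eq_bigr => i _; rewrite -(tmul_one fdM phi (ract _ _)) // tmul_ract.
congr tmul; rewrite factor_act_tinj; congr tinj; apply: esym; exact: mulr1.
Qed.

Lemma scalar_inj_grade r : scalar_inj r \in gr 0.
Proof. exact: (tinj_grade fdM phi (i := 0)). Qed.

(** * The duality form of a faithful grading *)

Section DualityForm.
Variables (s : 'Z_p.+2).
Hypothesis faithful : graded_faithful gr s.
Variable f : tpow M s -> dual_bimodule R.
Hypothesis f_hom : lmodule_hom f.
Hypothesis f_bij : bijective f.

(** The functional that recovers the isomorphism: f(x)(r) = form(r x). *)
Definition form (x : tpow M s) : K^o := (f x : 'Hom(R, K^o)) 1.

Lemma form_linear : linear form.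
Proof.
by move=> k x y; rewrite /form (proj1 f_hom) add_lfunE scale_lfunE.
Qed.

HB.instance Definition _ :=
  GRing.isLinear.Build K (tpow M s) K^o *:%R form form_linear.

Lemma form_lact r x : form (lact r x) = (f x : 'Hom(R, K^o)) r.
Proof. by rewrite /form (proj2 f_hom) /= dual_lactE mul1r. Qed.

Lemma form_eq0 x : (forall r, form (lact r x) = 0) -> x = 0.
Proof.
move=> x0; apply: (bij_inj f_bij).
have f0 : f 0 = 0.
  have [fL _] := f_hom; have := fL (-1) 0 0.
  by rewrite scaler0 addr0 scaleN1r addNr.
rewrite f0; apply/lfunP => r; rewrite -form_lact x0.
by apply: esym; exact: zero_lfunE.
Qed.

(** Replacing a by r a turns the vanishing of one functional into that of the
    whole element (a b)_s of M^s; then s-faithfulness applies. *)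
Lemma form_nondegenerate h b :
  (forall a, a \in gr h -> form ((a * b) s) = 0) -> b (s - h) = 0.
Proof.
move=> b0; apply: (tinj_inj (ltn_ord (s - h))); rewrite tinj0.
apply: (faithful (tinj_grade fdM phi _)) => a; rewrite subKr => ah.
have ab : a * tinj (b (s - h)) \in gr s.
  by have := factor_gradeM ah (tinj_grade fdM phi (b (s - h))); rewrite subrKC.
apply: (factor_grade_eq0 ab); apply: form_eq0 => r.
have rah : scalar_inj r * a \in gr h.
  by have := factor_gradeM (scalar_inj_grade r) ah; rewrite add0r.
rewrite -(b0 _ rah); congr form.
have := factor_mul_component (s - h) b rah; rewrite subrKC => ->.
by rewrite -mulrA scalar_injE.
Qed.

Lemma duality_linear b : linear (fun a : A => form ((a * b) s)).
Proof. by move=> k x y; rewrite mulrDl -scalerAl linearP. Qed.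

Definition duality b : 'Hom(A, K^o) :=
  linfun (linear_pack (duality_linear b)).

Lemma dualityE b a : duality b a = form ((a * b) s).
Proof. by rewrite lfunE. Qed.

(** The map b |-> form((- b)_s) from A to A^* is A-linear, and injective by
    nondegeneracy, hence bijective by equality of dimensions; theta is its
    inverse.  Nondegeneracy in a single degree gives the graded statement. *)
Lemma form_graded_frobenius : graded_frobenius gr s.
Proof.
have pL : linear duality.
  move=> k b c; apply/lfunP => a; rewrite add_lfunE scale_lfunE !dualityE.
  by rewrite mulrDr -scalerAr linearP.
pose P : 'Hom(A, 'Hom(A, K^o)) := linfun (linear_pack pL).
have PE b : P b = duality b by rewrite lfunE.
have kerP : lker P == 0%VS.
  apply/eqP/vspaceP=> b; rewrite memv_ker memv0 PE.
  apply/eqP/eqP=> [b0|->]; last by rewrite -PE linear0.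
  apply: factor_ext => i; rewrite -[i](subKr s).
  apply: form_nondegenerate => a _.
  by rewrite -dualityE b0 zero_lfunE.
have limP : limg P = fullv.
  apply/eqP; rewrite eqEdim subvf /= limg_dim_eq ?(eqP kerP) ?capv0 //.
  by rewrite !dimvf /dim /= muln1.
have Pinv f' : P (P^-1%VF f') = f' by rewrite limg_lfunVK // limP memvf.
have invP b : P^-1%VF (P b) = b by rewrite lker0_lfunK.
exists (P^-1)%VF; split.
- split=> [k u v|c u]; first exact: linearP.
  rewrite -{1}(Pinv u); set b := (P^-1)%VF u; rewrite -[RHS]invP.
  congr (P^-1%VF _).
  apply/lfunP=> a; rewrite /= dual_lactE !PE !dualityE.
  by rewrite mulrA.
- by exists P.
- move=> g u; rewrite -{1}(Pinv u); set b := (P^-1)%VF u.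
  split=> [ug|/factor_gradeP bg].
    apply/factor_gradeP=> j jg; rewrite -[j](subKr s).
    apply: form_nondegenerate => a ah.
    rewrite -dualityE -PE; apply: ug ah; apply: contra jg => /eqP jg.
    by rewrite -(opprK g) -jg opprB subrK.
  move=> h hg a ah; rewrite PE dualityE.
  have bgr : b \in gr (g + s) by apply/factor_gradeP.
  have /factor_gradeP -> := factor_gradeM ah bgr; first exact: linear0.
  rewrite addrA -{1}[s]add0r (inj_eq (addIr _)) eq_sym addr_eq0.
  exact: hg.
Qed.

End DualityForm.

Lemma faithful_graded_frobenius i :
  (i < p.+2)%N -> graded_faithful gr i%:R ->
  lmodule_iso (tpow M i) (dual_bimodule R) -> graded_frobenius gr i%:R.
Proof.
move=> lt_i; rewrite (natr_ord lt_i) => faithful [f f_hom f_bij].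
exact: (@form_graded_frobenius (Ordinal lt_i) faithful f f_hom f_bij).
Qed.
(** * The strongly graded case *)

(** When the degrees overflow, g + h = n + k, an element y of M^k is rewritten
    as phi(u) y = y, and each pure tensor w of u together with y is a word of
    length g + h, which splits into a word of length g and one of length h. *)
Lemma factor_strongly_graded (u : tpow M p.+2) :
  phi u = 1 :> R -> strongly_graded gr.
Proof.
move=> u1 g h; apply/eqP; rewrite eqEsubv; apply/andP; split.
  by have [_ _ _] := factor_is_grading fdM phi; apply.
set V := (gr g * gr h)%VS.
have VD k (x y : tpow M k) : tinj x \in V -> tinj y \in V -> tinj (x + y) \in V.
  by rewrite tinjD; exact: memvD.
have V0 k : tinj (0 : tpow M k) \in V by rewrite tinj0 mem0v.
have VZ r a : a \in V -> factor_act r a \in V.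
  have [_ _ _ grM] := factor_is_grading fdM phi.
  have: (gr 0%R * V <= V)%VS by rewrite prodvA prodvSl // -{2}[g]add0r grM.
  move/subvP=> V0V aV; rewrite -scalar_injE.
  exact/V0V/memv_mul/aV/scalar_inj_grade.
have Vtensor k (m : nat -> M) :
    nat_of_ord (g + h) = k -> tinj (ptensor k m) \in V.
  rewrite /= /Zp_trunc /= => kE; have [lt_gh|ge_gh] := ltnP (g + h)%N p.+2.
    rewrite -kE modn_small // -factor_mul_ptensor_lt //.
    exact: memv_mul (tinj_grade _ _ _) (tinj_grade _ _ _).
  have {}kE : (g + h)%N = (p.+2 + k)%N.
    rewrite -kE -{2}(subnKC ge_gh) modnDl modn_small ?subnKC //.
    rewrite ltn_subLR // -addSn leq_add // ltnW //; exact: ltn_ord.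
  rewrite -[ptensor k m]lact1 -u1; elim/ptensor_ind: (u) => [|v w hv hw|w].
  - have -> : phi 0 = 0.
      have [[phiL _] _] := assoc_morphism_hom phi; have := phiL (-1) 0 0.
      by rewrite scaler0 addr0 scaleN1r addNr.
    by rewrite lact0l.
  - have -> : phi (v + w) = phi v + phi w.
      have [[phiL _] _] := assoc_morphism_hom phi; have := phiL 1 v w.
      by rewrite !scale1r.
    by rewrite lactDl; exact: VD.
  (* the concatenated word w_0, .., w_(n-1), m_0, m_1, .. *)
  pose w' t := if (t < p.+2)%N then w t else m (t - p.+2)%N.
  rewrite (eq_ptensor (w := w')); last by move=> t; rewrite /w' => ->.
  rewrite (eq_ptensor (w := fun t => w' (p.+2 + t)%N) (v := m)); last first.
    by move=> t _; rewrite /w' ltnNge leq_addr /= addKn.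
  rewrite -(factor_mul_ptensor_ge fdM phi _ (ltn_ord g) (ltn_ord h) kE).
  exact: memv_mul (tinj_grade _ _ _) (tinj_grade _ _ _).
have Vall k (x : tpow M k) : nat_of_ord (g + h) = k -> tinj x \in V.
  case: k x => [|k] x kE.
    (* in degree 0 the only pure tensor is 1, which spans R over R *)
    have -> : tinj x = factor_act x (tinj (ptensor 0 (fun=> 0 : M))).
      by rewrite factor_act_tinj; congr Defs.tinj; exact: (esym (mulr1 _)).
    exact/VZ/Vtensor.
  elim/ptensor_ind: x => [|x y hx hy|m]; [exact: V0 | exact: VD |].
  exact: Vtensor.
by apply/subvP=> a /grade_tinj ->; exact: Vall.
Qed.

(** * The algebra of an invertible bimodule *)

Section Invertible.
Variables (N : bimodule R) (pl : M -> N -> R) (pr : N -> M -> R).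
Hypothesis pairing : morita_pairing pl pr.
Local Notation T k := (left_module (tpow M k)).

(** Peeling off the leftmost factor m of x: the product of the rest of x with y
    stays below the top degree, so m acts on it by mere tensoring, and
    [tcons_separates] applies. *)
Lemma tmul_tinj_eq0 i j (y : tpow M j) :
  (i + j < p.+2)%N -> (forall x : tpow M i, tmul x (tinj y) = 0) -> y = 0.
Proof.
elim: i => [|i IHi] lt_ij y0.
  apply: (tinj_inj lt_ij); rewrite tinj0 -[LHS]factor_act1.
  exact: (y0 1).
have lt_ij' := ltnW lt_ij; apply: IHi => // x.
have lt_j : (j < p.+2)%N by exact: leq_ltn_trans (leq_addl i j) lt_ij'.
have [z xy] : exists z : tpow M (i + j), tmul x (tinj y) = tinj z.
  have /grade_tinj xy : tmul x (tinj y) \in gr (Ordinal lt_ij' : 'Z_p.+2).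
    have := tmul_grade x (tinj_natr_grade y lt_j).
    by rewrite -natrD (natr_ord lt_ij').
  by exists (tmul x (tinj y) (Ordinal lt_ij')).
suff z0 : z = 0 by rewrite xy z0 tinj0.
apply: (tcons_separates pairing) => m; rewrite tcons0r.
apply: (tinj_inj lt_ij).
by rewrite -mcons_tinj // -xy -tmul_tcons y0 tinj0.
Qed.

(** By fullness, F is obtained by tensoring a map from M^(i-1) to M^(k-1) with
    M; after i such steps the source is R, and y is the value at 1. *)
Lemma left_hom_tmul i j k (F : {linear T i -> T k}) :
  (i + j)%N = k -> (k < p.+2)%N ->
  exists y : tpow M j, forall x, tmul x (tinj y) = tinj (F x).
Proof.
elim: i k F => [|i IHi] k F; rewrite ?add0n => ij_k lt_k.
  case: _ / ij_k in F lt_k *; exists (F (1 : R)) => x /=.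
  rewrite factor_act_tinj; congr Defs.tinj.
  by rewrite -[x in RHS]mulr1; apply: esym; exact: (linearZ_LR F).
case: k F ij_k lt_k => // k F [ij_k] lt_k.
have [F' F'E] := hom_tcons pairing F.
have [y yE] := IHi k F' ij_k (ltnW lt_k); exists y.
elim/tpow_ind=> [|x z hx hz|m x].
- by rewrite tmul0l [F 0](raddf0 F) tinj0.
- by rewrite tmulDl hx hz -tinjD; congr Defs.tinj; apply: esym; exact: raddfD.
- by rewrite tmul_tcons yE mcons_tinj // F'E.
Qed.

Definition top_component (a : A) : T p.+1 := a (ord_max : 'Z_p.+2).

Lemma top_componentD : {morph top_component : a b / a + b}.
Proof. by []. Qed.

Lemma top_componentZ r a :
  top_component (scalar_inj r * a) = r *: top_component a.
Proof. by rewrite scalar_injE. Qed.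

Lemma top_component_tinj (x : tpow M p.+1) : top_component (tinj x) = x.
Proof. exact: (tinj_val fdM phi (i := ord_max)). Qed.

Lemma ord_max_natr : ord_max = (p.+1)%:R :> 'Z_p.+2.
Proof. by rewrite natr_ord; exact: val_inj. Qed.

(** G is represented on each component M^i separately, by an element of
    complementary degree n - 1 - i; these elements are then added. *)
Lemma top_component_repr (G : A -> T p.+1) :
  {morph G : a b / a + b} ->
  (forall r a, G (scalar_inj r * a) = r *: G a) ->
  exists b, forall a, G a = top_component (a * b).
Proof.
move=> GD GZ; have G0 : G 0 = 0 by apply: (addrI (G 0)); rewrite -GD !addr0.
have /choice[c cP] i : exists c : A, c \in gr (ord_max - i) /\
    forall x : tpow M i, tmul x c = tinj (G (tinj x)).
  have FL : linear (fun x : T i => G (tinj x)).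
    move=> r x y; rewrite [tinj _]tinjD GD; congr (_ + _).
    by rewrite -GZ scalar_injE factor_act_tinj.
  have le_i : (i <= p.+1)%N by rewrite -ltnS; exact: ltn_ord.
  have [y yE] := left_hom_tmul (linear_pack FL) (subnKC le_i) (ltnSn _).
  exists (tinj y); split=> //.
  have := tinj_natr_grade y (leq_ltn_trans (leq_subr i p.+1) (ltnSn _)).
  by rewrite natrB // natr_Zp ord_max_natr.
exists (\sum_i c i) => a.
rewrite [in LHS](factor_decomp a) (big_morph G GD G0).
rewrite [X in top_component X]factor_mulE.
have top0 : top_component 0 = 0 by [].
have top_sum := big_morph top_component top_componentD top0.
rewrite top_sum; apply: eq_bigr => i _; rewrite tmul_sum top_sum (bigD1 i) //=.
have [_ ->] := cP i; rewrite top_component_tinj big1 ?addr0 // => h hi.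
have [ch _] := cP h.
have /factor_gradeP/(_ ord_max) max0 := tmul_grade (a i) ch.
apply: max0; rewrite natr_Zp.
by rewrite addrCA -subr_eq0 opprD addNKr oppr_eq0 subr_eq0 eq_sym.
Qed.

Lemma top_component_inj b : (forall a, top_component (a * b) = 0) -> b = 0.
Proof.
move=> b0; apply: factor_ext => i.
have le_i : (i <= p.+1)%N by rewrite -ltnS; exact: ltn_ord.
have i_max : (p.+1 - i)%:R + i = ord_max.
  by rewrite natrB // natr_Zp subrK ord_max_natr.
apply: (@tmul_tinj_eq0 (p.+1 - i) i); first by rewrite subnK.
move=> x; apply: (@factor_grade_eq0 ord_max).
  by rewrite -i_max; exact: tmul_grade (tinj_grade _ _ _).
rewrite -(tmul_component _ _ i_max) -factor_mul_tinj ?b0 //.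
  exact: (b0 (tinj x)).
exact: leq_ltn_trans (leq_subr _ _) _.
Qed.

Lemma factor_quasi_frobenius : quasi_frobenius A <-> quasi_frobenius R.
Proof.
have H := injective_tpow pairing p.+1; split=> [injA|/H injT]; last first.
  exact: (injective_coinduced (j := scalar_inj) top_componentD
            top_componentZ top_component_repr top_component_inj).
apply/H; pose eps (a : A) : R := a 0.
apply: (@injective_of_coinduced R A (scalar_inj) _ _ top_componentD
   top_componentZ top_component_repr top_component_inj eps) => //.
- by move=> r a; rewrite scalar_injE.
- by move=> r a; rewrite mul_scalar_inj.
- by rewrite /eps factor_oneE (tinj_val _ _ (i := 0)).
Qed.

Lemma invertible_faithful : graded_faithful gr (p.+1)%:R.
Proof.
move=> g a ag a0; apply: (factor_grade_eq0 ag).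
have le_g : (g <= p.+1)%N by rewrite -ltnS; exact: ltn_ord.
have lt_g : (p.+1 - g < p.+2)%N by rewrite ltnS leq_subr.
apply: (@tmul_tinj_eq0 (p.+1 - g) g); first by rewrite subnK.
move=> x; rewrite -(grade_tinj ag) -factor_mul_tinj //; apply: a0.
by have := tinj_natr_grade x lt_g; rewrite natrB // natr_Zp.
Qed.

End Invertible.
End Factor.

Theorem propositionA (K : fieldType) (R : falgType K) (M : bimodule R)
    (p : nat) (fdM : finite_dimensional M) (phi : assoc_morphism M p.+2) :
  let A : falgType K := factor_alg fdM phi in
  let gr : 'Z_p.+2 -> {vspace A} := @factor_grade K R M p fdM phi in
  [/\ invertible_bimodule M ->
        graded_faithful gr (p.+1)%:R /\
        (lmodule_iso (tpow M p.+1) (dual_bimodule R) ->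
           graded_frobenius gr (p.+1)%:R /\ frobenius A),
      invertible_bimodule M -> (quasi_frobenius A <-> quasi_frobenius R),
      bijective phi -> strongly_graded gr
    & bijective phi ->
        forall i : nat, (i <= p.+1)%N ->
          lmodule_iso (tpow M i) (dual_bimodule R) ->
          graded_frobenius gr i%:R /\ frobenius A].
Proof.
move=> A gr.
have frob i : (i <= p.+1)%N -> graded_faithful gr i%:R ->
    lmodule_iso (tpow M i) (dual_bimodule R) ->
    graded_frobenius gr i%:R /\ frobenius A.
  move=> le_i faithful iso_i.
  have fr : graded_frobenius gr i%:R by exact: faithful_graded_frobenius.
  by split=> //; exact: graded_frobenius_frobenius fr.
have strong : bijective phi -> strongly_graded gr.
  by move=> [phi' _ phi'K]; exact: (factor_strongly_graded fdM (phi'K 1)).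
split=> //.
- move=> /invertible_pairing[N [pl [pr pairing]]].
  have faithful : graded_faithful gr (p.+1)%:R := invertible_faithful pairing.
  by split=> //; exact: frob.
- move=> /invertible_pairing[N [pl [pr pairing]]].
  exact: factor_quasi_frobenius pairing.
- move=> /strong sg i le_i; apply: frob => //.
  exact: strongly_graded_faithful (factor_is_grading fdM phi) sg.
Qed.
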